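(* Let $G:\mathbb{R}^n\to\mathbb{R}^d$ be twice continuously differentiable, let $D\subset\mathbb{R}^d$ be polyhedral, and let $\Gamma=\{x\in\mathbb{R}^n\mid G(x)\in D\}$. Let $\bar x\in\Gamma$ and $u\in L_\Gamma(\bar x)$ and suppose that the MSCQ holds at $\bar x$ in direction $u$ with the subregularity modulus $\kappa$. Then the following statements hold. (i) For every $x^*\in\{u\}^\perp$ we have $${\rm d}^2\delta_\Gamma(\bar x;x^* )(u)=-\sigma_{T^2_\Gamma(\bar x;u)}(x^* ).\qquad( * )$$ (ii) We have $\mathrm{dom}\,\sigma_{T^2_\Gamma(\bar x;u)}=\widehat N^p_\Gamma(\bar x;u)=\widehat N_{T_\Gamma(\bar x)}(u)$. For every $x^*\in\mathrm{dom}\,\sigma_{T^2_\Gamma(\bar x;u)}$ we have $x^*\in\{u\}^\perp$, equality $( * )$ holds, and $$\inf_{y^*\in\Lambda_{x^*}(\bar x;u)\cap\kappa\|x^*\|{\rm cl}\,\mathbb{B}}\langle y^*,\nabla^2G(\bar x)(u,u)\rangle\le{\rm d}^2\delta_\Gamma(\bar x;x^* )(u)\le\sup_{y^*\in\Lambda_{x^*}(\bar x;u)\cap\kappa\|x^*\|{\rm cl}\,\mathbb{B}}\langle y^*,\nabla^2G(\bar x)(u,u)\rangle,$$ $${\rm d}^2\delta_\Gamma(\bar x;x^* )(u)\ge\sup_{y^*\in\Lambda^s_{x^*}(\bar x;u)}\langle y^*,\nabla^2G(\bar x)(u,u)\rangle,$$ and, moreover, there exists $y^*\in\Lambda_{x^*}(\bar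 x;u)$ such that ${\rm d}^2\delta_\Gamma(\bar x;x^* )(u)=\langle y^*,\nabla^2G(\bar x)(u,u)\rangle$. (iii) We have $\mathrm{dom}\,\hat\sigma_{T^2_\Gamma(\bar x;u)}\subset\{x^*\mid\Lambda_{x^*}(\bar x;u)\ne\emptyset\}$ and for every $x^*\in\mathrm{dom}\,\hat\sigma_{T^2_\Gamma(\bar x;u)}$ it holds $$\inf_{y^*\in\Lambda_{x^*}(\bar x;u)\cap\kappa\|x^*\|{\rm cl}\,\mathbb{B}}\langle y^*,\nabla^2G(\bar x)(u,u)\rangle\le-\hat\sigma_{T^2_\Gamma(\bar x;u)}(x^* )\le\sup_{y^*\in\Lambda_{x^*}(\bar x;u)\cap\kappa\|x^*\|{\rm cl}\,\mathbb{B}}\langle y^*,\nabla^2G(\bar x)(u,u)\rangle$$ and there exists $y^*\in\Lambda_{x^*}(\bar x;u)$ such that $-\hat\sigma_{T^2_\Gamma(\bar x;u)}(x^* )=\langle y^*,\nabla^2G(\bar x)(u,u)\rangle$. Moreover, the upper bound in the last displayed chain of inequalities is valid for all $x^*\in\mathbb{R}^n$.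
   Context: A set is convex polyhedral if it is the intersection of finitely many halfspaces, and polyhedral if it is the union of finitely many convex polyhedral sets. $\mathbb{B}$ is the open unit ball, ${\rm cl}\,\mathbb{B}$ its closure, $\{u\}^\perp$ the orthogonal complement of $u$. $\nabla^2G(x)(u,u)=(u^T\nabla^2G_1(x)u,\dots,u^T\nabla^2G_d(x)u)^T$. For $\varphi:\mathbb{R}^n\to[-\infty,\infty]$, $\mathrm{dom}\,\varphi=\{z\mid\varphi(z)<+\infty\}$. Conventions: $\sup\emptyset=-\infty$, $\inf\emptyset=+\infty$. For a set $S$ and $z\in S$: tangent cone $T_S(z)=\{w\mid\exists t_k\downarrow0,\ w_k\to w:\ z+t_kw_k\in S\}$; outer second-order tangent set $T^2_S(z;w)=\{s\mid\exists t_k\downarrow0,\ s_k\to s:\ z+t_kw+\frac12t_k^2s_k\in S\}$; regular normal cone $\widehat N_S(z)=\{z^*\mid\langle z^*,z'-z\rangle\le o(\|z'-z\|)\ \forall z'\in S\}$; limiting normal cone $N_S(z)=\{z^*\mid\exists z_k\to z,\ z_k\in S,\ z_k^*\to z^*,\ z_k^*\in\widehat N_S(z_k)\}$. Directional neighborhood: $V_{\delta,\rho}(w)=\{w'\in\delta\mathbb{B}\mid\big\|\|w\|w'-\|w'\|w\big\|\le\rho\|w'\|\|w\|\}$ for $\delta,\rho>0$. Directional proximal normal cone: for $w\in T_S(z)$, let $\hat{\mathcal N}^p_S(z;w)=\{z^*\mid\exists\delta,\rho,\gamma>0:\ \langle z^*,z'-z\rangle\le\gamma\|z'-z\|^2\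 \forall z'\in S\cap(z+V_{\delta,\rho}(w))\}$ and $\widehat N^p_S(z;w)=\hat{\mathcal N}^p_S(z;w)\cap\{w\}^\perp$; if $w\notin T_S(z)$ both are empty. Support function: $\sigma_S(z^* )=\sup\{\langle z^*,z\rangle\mid z\in S\}$. Lower generalized support function of a nonempty closed $S$: $\hat\sigma_S(z^* )=\liminf_{\tilde z^*\to z^*}\inf_z\{\langle\tilde z^*,z\rangle\mid\tilde z^*\in\widehat N_S(z)\}$, and $\hat\sigma_\emptyset\equiv-\infty$. Second subderivative of the indicator function: ${\rm d}^2\delta_S(z;z^* )(w)=\liminf_{t\downarrow0,\ w'\to w,\ z+tw'\in S}\frac{-2\langle z^*,w'\rangle}{t}$ (equal to $+\infty$ if $w\notin T_S(z)$). MSCQ at $\bar x$ in direction $u$ (metric subregularity of $x\rightrightarrows G(x)-D$ at $(\bar x,0)$ in direction $u$): there exist $\kappa,\delta,\rho>0$ with ${\rm dist}(x,\Gamma)\le\kappa\,{\rm dist}(G(x),D)$ for all $x\in\bar x+V_{\delta,\rho}(u)$. The infimum of all $\kappa$ for which such $\delta,\rho>0$ exist is the subregularity modulus. Linearization cone: $L_\Gamma(\bar x)=\{u\mid\nabla G(\bar x)u\in T_D(G(\bar x))\}$. Multiplier sets for $x^*\in\mathbb{R}^n$: $\Lambda^s_{x^*}(\bar x;u)=\{y^*\in\widehat N_{T_D(G(\bar x))}(\nabla G(\bar x)u)\mid x^*=\nabla G(\bar x)^Ty^*\}$ and $\Lambda_{x^*}(\bar x;u)=\{y^*\in N_{T_D(G(\bar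 x))}(\nabla G(\bar x)u)\mid x^*=\nabla G(\bar x)^Ty^*\}$. *)

(* Defs.v *)
From mathcomp Require Import all_boot all_order all_algebra.
From mathcomp Require Import all_classical all_reals all_analysis.

Set Implicit Arguments.
Unset Strict Implicit.
Unset Printing Implicit Defensive.

Import Order.TTheory GRing.Theory Num.Theory.
Import numFieldNormedType.Exports.

Local Open Scope classical_set_scope.
Local Open Scope ring_scope.

(* Points of R^n are row vectors.  The library norm on matrices is the max
   norm; it induces the usual topology, but the inner product and the Euclidean
   norm have to be introduced. *)
Definition dot (R : realType) (n : nat) (x y : 'rV[R]_n) : R :=
  \sum_(i < n) x 0 i * y 0 i.

Definition enorm (R : realType) (n : nat) (x : 'rV[R]_n) : R :=
  Num.sqrt (dot x x).

Definition orth (R : realType) (n : nat) (u : 'rV[R]_n) : set 'rV[R]_n :=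
  [set x | dot u x = 0].

Definition cl_eball (R : realType) (n : nat) (r : R) : set 'rV[R]_n :=
  [set x | enorm x <= r].

(* +oo when S is empty *)
Definition dist (R : realType) (n : nat) (x : 'rV[R]_n) (S : set 'rV[R]_n) :
    \bar R :=
  ereal_inf [set (enorm (x - z))%:E | z in S].

Definition effdom (R : realType) (T : Type) (phi : T -> \bar R) : set T :=
  [set z | (phi z < +oo)%E].

Definition halfspace (R : realType) (n : nat) (H : set 'rV[R]_n) : Prop :=
  exists (a : 'rV[R]_n) (b : R), a != 0 /\ H = [set z | dot a z <= b].

Definition convex_polyhedral (R : realType) (n : nat) (S : set 'rV[R]_n) :
    Prop :=
  exists (m : nat) (H : 'I_m -> set 'rV[R]_n),
    (forall i, halfspace (H i)) /\ S = \bigcap_i H i.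

Definition polyhedral (R : realType) (n : nat) (S : set 'rV[R]_n) : Prop :=
  exists (m : nat) (P : 'I_m -> set 'rV[R]_n),
    (forall i, convex_polyhedral (P i)) /\ S = \bigcup_i P i.

(* The library Jacobian acts on row vectors from the right: 'J G x is the
   transpose of the d x n matrix usually written as the Jacobian of G at x, so
   that u *m 'J G x is the derivative of G at x applied to u, and
   y *m ('J G x)^T is the transposed Jacobian applied to y. *)
Definition grad_comp (R : realType) (n d : nat) (G : 'rV[R]_n -> 'rV[R]_d)
    (i : 'I_d) (x : 'rV[R]_n) : 'rV[R]_n :=
  (col i ('J G x))^T.

Definition hess_comp (R : realType) (n d : nat) (G : 'rV[R]_n -> 'rV[R]_d)
    (i : 'I_d) (x : 'rV[R]_n) : 'M[R]_n :=
  'J (grad_comp G i) x.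

Definition twice_cont_diff (R : realType) (n d : nat)
    (G : 'rV[R]_n -> 'rV[R]_d) : Prop :=
  (forall x, differentiable G x) /\
  (forall i, (forall x, differentiable (grad_comp G i) x) /\
             continuous (hess_comp G i)).

Definition hess_quad (R : realType) (n d : nat) (G : 'rV[R]_n -> 'rV[R]_d)
    (x u : 'rV[R]_n) : 'rV[R]_d :=
  \row_(i < d) dot u (u *m hess_comp G i x).

Definition tangent_cone (R : realType) (n : nat) (S : set 'rV[R]_n)
    (z : 'rV[R]_n) : set 'rV[R]_n :=
  [set w | exists (t : nat -> R) (v : nat -> 'rV[R]_n),
     [/\ forall k, 0 < t k, t k @[k --> \oo] --> (0 : R),
         v k @[k --> \oo] --> w & forall k, S (z + t k *: v k)]].

Definition tangent_set2 (R : realType) (n : nat) (S : set 'rV[R]_n)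
    (z w : 'rV[R]_n) : set 'rV[R]_n :=
  [set s | exists (t : nat -> R) (v : nat -> 'rV[R]_n),
     [/\ forall k, 0 < t k, t k @[k --> \oo] --> (0 : R),
         v k @[k --> \oo] --> s &
         forall k, S (z + t k *: w + (2^-1 * t k ^+ 2) *: v k)]].

(* Both normal cones are empty at points outside S; for regular_normal this
   matters in lower_support below, where z ranges over the whole space. *)
Definition regular_normal (R : realType) (n : nat) (S : set 'rV[R]_n)
    (z : 'rV[R]_n) : set 'rV[R]_n :=
  [set zs | S z /\ forall e : R, 0 < e ->
     \forall z' \near z, S z' -> dot zs (z' - z) <= e * enorm (z' - z)].

Definition limiting_normal (R : realType) (n : nat) (S : set 'rV[R]_n)
    (z : 'rV[R]_n) : set 'rV[R]_n :=
  [set zs | S z /\ exists (v vs : nat -> 'rV[R]_n),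
     [/\ v k @[k --> \oo] --> z, forall k, S (v k),
         vs k @[k --> \oo] --> zs & forall k, regular_normal S (v k) (vs k)]].

Definition dir_nbhd (R : realType) (n : nat) (delta rho : R) (w : 'rV[R]_n) :
    set 'rV[R]_n :=
  [set w' | enorm w' < delta /\
     enorm (enorm w *: w' - enorm w' *: w) <= rho * enorm w' * enorm w].

Definition dir_proximal_prenormal (R : realType) (n : nat)
    (S : set 'rV[R]_n) (z w : 'rV[R]_n) : set 'rV[R]_n :=
  [set zs | tangent_cone S z w /\
     exists delta rho gamma : R, [/\ 0 < delta, 0 < rho, 0 < gamma &
       forall z', S z' -> dir_nbhd delta rho w (z' - z) ->
         dot zs (z' - z) <= gamma * enorm (z' - z) ^+ 2]].

Definition dir_proximal_normal (R : realType) (n : nat)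
    (S : set 'rV[R]_n) (z w : 'rV[R]_n) : set 'rV[R]_n :=
  dir_proximal_prenormal S z w `&` orth w.

Definition support_fun (R : realType) (n : nat) (S : set 'rV[R]_n)
    (zs : 'rV[R]_n) : \bar R :=
  ereal_sup [set (dot zs z)%:E | z in S].

(* The liminf is over full, not punctured, neighbourhoods of zs. *)
Definition lower_support (R : realType) (n : nat) (S : set 'rV[R]_n)
    (zs : 'rV[R]_n) : \bar R :=
  if `[< S = set0 >] then -oo%E else
  limf_einf
    (fun zt => ereal_inf [set (dot zt z)%:E | z in [set z | regular_normal S z zt]])
    (nbhs zs).

(* Second subderivative of the indicator function of S.  The filter is improper,
   and the liminf equal to +oo, exactly when w is not tangent to S at z. *)
Definition subderiv2_indic (R : realType) (n : nat) (S : set 'rV[R]_n)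
    (z zs w : 'rV[R]_n) : \bar R :=
  limf_einf (fun p : R * 'rV[R]_n => (- 2 * dot zs p.2 / p.1)%:E)
    (within [set p | S (z + p.1 *: p.2)] (filter_prod (0 : R)^'+ (nbhs w))).

Section constraint_system.
Variables (R : realType) (n d : nat) (G : 'rV[R]_n -> 'rV[R]_d).
Variables (D : set 'rV[R]_d) (xbar u : 'rV[R]_n).

Definition feasible : set 'rV[R]_n := [set x | D (G x)].

Definition mscq_const (k : R) : Prop :=
  0 < k /\ exists delta rho : R, [/\ 0 < delta, 0 < rho &
    forall x, dir_nbhd delta rho u (x - xbar) ->
      (dist x feasible <= k%:E * dist (G x) D)%E].

Definition mscq : Prop := exists k, mscq_const k.

Definition subreg_modulus : R := inf [set k | mscq_const k].

Definition lin_cone : set 'rV[R]_n :=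
  [set v | tangent_cone D (G xbar) (v *m 'J G xbar)].

Definition multipliers_s (xs : 'rV[R]_n) : set 'rV[R]_d :=
  [set y | regular_normal (tangent_cone D (G xbar)) (u *m 'J G xbar) y /\
           xs = y *m ('J G xbar)^T].

Definition multipliers (xs : 'rV[R]_n) : set 'rV[R]_d :=
  [set y | limiting_normal (tangent_cone D (G xbar)) (u *m 'J G xbar) y /\
           xs = y *m ('J G xbar)^T].

End constraint_system.

(* Main.v *)
Require Import Defs.
From mathcomp Require Import all_boot all_order all_algebra.
From mathcomp Require Import all_classical all_reals all_analysis.
From mathcomp Require Import ring lra.

(** Near [G xbar] the set [D] is [G xbar + C] for a polyhedral cone [C], and near
    [v = (DG xbar) u] the cone [C] is [v + K] for another polyhedral cone [K].
    Writing feasible points as [xbar + t u + (t^2/2) s], a second-order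
    expansion of [G] together with MSCQ shows that the second-order tangent set
    is the polyhedral set [M = {s | A s + h in K}], with [A] the Jacobian and
    [h] the second derivative along [u], and that [M] satisfies the global error
    bound [dist(s, M) <= kappa dist(A s + h, K)].  Because this bound is global,
    a feasible [xbar + t u + (t^2/2) s] with [t s -> 0] is close to [M] even for
    unbounded [s], which gives the formula for the second subderivative.  The
    bounds on multipliers come from exact penalisation: a regular normal
    to [M] at [z] is approximated by [A^T y] with [y] a regular normal to [K]
    at some [p] and [|y| <= kappa |x|]; since [K] is a cone, [<y, p> = 0], and so
    [<x, z> = - <y, h>] up to a small error. *)

Set Implicit Arguments.
Unset Strict Implicit.
Unset Printing Implicit Defensive.

Import Order.TTheory GRing.Theory Num.Theory.
Import numFieldNormedType.Exports.

Local Open Scope classical_set_scope.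
Local Open Scope ring_scope.

(** * Euclidean norm, its topology, and compactness of balls *)

Section euclidean.
Context {R : realType}.

(** Nothing here is convex: [K] and [M] are finite unions of polyhedra, so neither duality nor
    recession-cone calculus applies directly, and the global error bound takes over both roles. The
    descriptions of the domain in (ii) meet in a single condition: [x] is nonpositive on
    [M0 = {w | w A in K}]. The error bound keeps [M] and [M0] within bounded distance of each other,
    so the condition amounts to boundedness above of [x] on [M]. Moreover [M0] is the local cone at
    [u] of the tangent cone of the feasible set, so the condition is also regular normality there.
    The modulus [kappa] is an infimum that may itself fail as a constant. The multiplier estimates
    therefore carry additive slacks, and exact multipliers appear only at the end, as cluster points
    in a ball. The points [z] and [p] that accompany them may escape to infinity; this is harmless,
    because a regular normal to the cone [K] at [p] is one at [t p] for all [t > 0]. *)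

Lemma dotE n (x y : 'rV[R]_n) : dot x y = (x *m y^T) 0 0.
Proof. by rewrite mxE; apply: eq_bigr => i _; rewrite mxE. Qed.

Lemma dotC n (x y : 'rV[R]_n) : dot x y = dot y x.
Proof. by apply: eq_bigr => i _; rewrite mulrC. Qed.

Lemma dotDl n (x y z : 'rV[R]_n) : dot (x + y) z = dot x z + dot y z.
Proof. by rewrite !dotE mulmxDl mxE. Qed.

Lemma dotZl n a (x z : 'rV[R]_n) : dot (a *: x) z = a * dot x z.
Proof. by rewrite !dotE -scalemxAl mxE. Qed.

Lemma dotNl n (x z : 'rV[R]_n) : dot (- x) z = - dot x z.
Proof. by rewrite -scaleN1r dotZl mulN1r. Qed.

Lemma dotBl n (x y z : 'rV[R]_n) : dot (x - y) z = dot x z - dot y z.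
Proof. by rewrite dotDl dotNl. Qed.

Lemma dotDr n (x y z : 'rV[R]_n) : dot z (x + y) = dot z x + dot z y.
Proof. by rewrite !(dotC z) dotDl. Qed.

Lemma dotZr n a (x z : 'rV[R]_n) : dot z (a *: x) = a * dot z x.
Proof. by rewrite !(dotC z) dotZl. Qed.

Lemma dotBr n (x y z : 'rV[R]_n) : dot z (x - y) = dot z x - dot z y.
Proof. by rewrite !(dotC z) dotBl. Qed.

Lemma dot0l n (z : 'rV[R]_n) : dot 0 z = 0.
Proof. by rewrite -(scale0r 0) dotZl mul0r. Qed.

Lemma dot0r n (z : 'rV[R]_n) : dot z 0 = 0.
Proof. by rewrite dotC dot0l. Qed.

Lemma dot_mulmx n d (A : 'M[R]_(n, d)) (w : 'rV[R]_n) (y : 'rV[R]_d) :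
  dot (w *m A) y = dot w (y *m A^T).
Proof. by rewrite !dotE trmx_mul trmxK mulmxA. Qed.

Lemma dot_ge0 n (x : 'rV[R]_n) : 0 <= dot x x.
Proof. by apply: sumr_ge0 => i _; rewrite -expr2 sqr_ge0. Qed.

Lemma enorm_ge0 n (x : 'rV[R]_n) : 0 <= enorm x.
Proof. exact: sqrtr_ge0. Qed.

Lemma sqr_enorm n (x : 'rV[R]_n) : enorm x ^+ 2 = dot x x.
Proof. by rewrite sqr_sqrtr ?dot_ge0. Qed.

Lemma coord_le_enorm n (x : 'rV[R]_n) i : `|x 0 i| <= enorm x.
Proof.
rewrite -sqrtr_sqr ler_wsqrtr // /dot (bigD1 i) //= -expr2 lerDl.
by apply: sumr_ge0 => j _; rewrite -expr2 sqr_ge0.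
Qed.

Lemma enorm1_gt0 n (x : 'rV[R]_n) : 0 < enorm x + 1.
Proof. by rewrite ltr_wpDl // enorm_ge0. Qed.

Lemma enorm_eq0 n (x : 'rV[R]_n) : enorm x = 0 -> x = 0.
Proof.
move=> x0; apply/rowP => i; rewrite mxE; apply/eqP.
by rewrite -normr_le0 -x0 coord_le_enorm.
Qed.

Lemma enorm0 n : enorm (0 : 'rV[R]_n) = 0.
Proof. by rewrite /enorm dot0l sqrtr0. Qed.

Lemma enormZ n a (x : 'rV[R]_n) : enorm (a *: x) = `|a| * enorm x.
Proof.
rewrite /enorm dotZl dotZr mulrA -expr2 sqrtrM ?sqr_ge0 //.
by rewrite sqrtr_sqr.
Qed.

Lemma enormN n (x : 'rV[R]_n) : enorm (- x) = enorm x.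
Proof. by rewrite -scaleN1r enormZ normrN normr1 mul1r. Qed.

Lemma enormBC n (x y : 'rV[R]_n) : enorm (x - y) = enorm (y - x).
Proof. by rewrite -enormN opprB. Qed.

Lemma dot_le n (x y : 'rV[R]_n) : dot x y <= enorm x * enorm y.
Proof.
have [y0|] := eqVneq (enorm y) 0.
  by rewrite y0 mulr0 (enorm_eq0 y0) dot0r.
move=> yn0; have yp : 0 < enorm y by rewrite lt_def yn0 enorm_ge0.
have [x0|] := eqVneq (enorm x) 0.
  by rewrite x0 mul0r (enorm_eq0 x0) dot0l.
move=> xn0; have xp : 0 < enorm x by rewrite lt_def xn0 enorm_ge0.
have := dot_ge0 (enorm y *: x - enorm x *: y).
rewrite dotBl !dotBr !dotZl !dotZr -!sqr_enorm (dotC y x).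
set a := enorm x in xp *; set b := enorm y in yp *; set c := dot x y.
move=> H; have ab : 0 < a * b by rewrite mulr_gt0.
have : 0 <= a * b * (a * b - c) by nra.
by rewrite pmulr_rge0 // subr_ge0.
Qed.

Lemma dot_abs_le n (x y : 'rV[R]_n) : `|dot x y| <= enorm x * enorm y.
Proof.
rewrite ler_norml dot_le andbT lerNl -dotNl.
by rewrite -(enormN x) dot_le.
Qed.

Lemma enormD n (x y : 'rV[R]_n) : enorm (x + y) <= enorm x + enorm y.
Proof.
rewrite -(@ler_pXn2r _ 2) ?nnegrE ?addr_ge0 ?enorm_ge0 //.
rewrite sqr_enorm dotDl !dotDr (dotC y x) sqrrD -!sqr_enorm.
have := dot_le x y; lra.
Qed.

Lemma enormB n (x y : 'rV[R]_n) : enorm (x - y) <= enorm x + enorm y.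
Proof. by rewrite -(enormN y) enormD. Qed.

Lemma enorm_distD n (z x y : 'rV[R]_n) :
  enorm (x - y) <= enorm (x - z) + enorm (z - y).
Proof. by rewrite -[x in enorm (x - y)](subrK z) -addrA enormD. Qed.

Lemma enorm_lerB n (x y : 'rV[R]_n) : enorm x - enorm y <= enorm (x - y).
Proof. by rewrite lerBlDr -[X in enorm X <= _](subrK y) enormD. Qed.

Lemma enorm_sum n (I : finType) (f : I -> 'rV[R]_n) :
  enorm (\sum_i f i) <= \sum_i enorm (f i).
Proof.
elim/big_ind2 : _ => [|x a y b xa yb|//]; first by rewrite enorm0.
by rewrite (le_trans (enormD _ _)) // lerD.
Qed.

Lemma norm_le_enorm n (x : 'rV[R]_n) : `|x| <= enorm x.
Proof.
rewrite [leLHS]/Num.norm /= mx_normrE; apply/bigmax_leP; split=> [|[i j] _ /=].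
  exact: enorm_ge0.
by rewrite ord1 coord_le_enorm.
Qed.

Lemma coord_le_norm n (x : 'rV[R]_n) i : `|x 0 i| <= `|x|.
Proof.
rewrite [leRHS]/Num.norm /= mx_normrE.
by apply/bigmax_geP; right => /=; exists (0, i).
Qed.

Lemma enorm_le_norm n :
  exists2 c : R, 0 < c & forall x : 'rV[R]_n, enorm x <= c * `|x|.
Proof.
exists (1 + \sum_(i < n) enorm (delta_mx 0 i : 'rV[R]_n)).
  by rewrite ltr_wpDr // sumr_ge0 // => i _; exact: enorm_ge0.
move=> x; rewrite [x in enorm x]row_sum_delta (le_trans (enorm_sum _)) //.
rewrite mulrDl mul1r mulr_suml ler_wpDl // ler_sum // => i _.
by rewrite enormZ mulrC ler_wpM2l ?enorm_ge0 // coord_le_norm.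
Qed.

Lemma enorm_mulmx n d (A : 'M[R]_(n, d)) :
  exists2 c : R, 0 <= c & forall w, enorm (w *m A) <= c * enorm w.
Proof.
exists (\sum_i enorm (row i A)); first by rewrite sumr_ge0 // => i _; exact: enorm_ge0.
move=> w; rewrite mulmx_sum_row (le_trans (enorm_sum _)) // mulr_suml.
apply: ler_sum => i _; rewrite enormZ mulrC ler_wpM2l ?enorm_ge0 //.
exact: coord_le_enorm.
Qed.

Lemma nbhs_enormP n (z : 'rV[R]_n) (P : set 'rV[R]_n) :
  nbhs z P <-> exists2 e, 0 < e & forall x, enorm (x - z) < e -> P x.
Proof.
split=> [/nbhs_ballP[e /= e0 eP]|[e e0 eP]].
  exists e => // x xe; apply: eP; rewrite -ball_normE /= distrC.
  exact: le_lt_trans (norm_le_enorm _) xe.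
have [c c0 cP] := enorm_le_norm n.
apply/nbhs_ballP; exists (e / c) => /=; first by rewrite divr_gt0.
move=> x; rewrite -ball_normE /= distrC ltr_pdivlMr // => xe; apply: eP.
by rewrite (le_lt_trans (cP _)) // mulrC.
Qed.

Lemma cvg_enormP n (v : nat -> 'rV[R]_n) (z : 'rV[R]_n) :
  v k @[k --> \oo] --> z <->
  forall e, 0 < e -> exists N : nat, forall k, (N <= k)%N -> enorm (v k - z) < e.
Proof.
split=> [vz e e0|vz P /nbhs_enormP[e e0 eP]].
  have /vz[N _ NP] : nbhs z [set x | enorm (x - z) < e].
    by apply/nbhs_enormP; exists e.
  by exists N => k /NP.
have [N NP] := vz _ e0; exists N => // k /= Nk; apply: eP; exact: NP.
Qed.

Lemma cvg0_seqP (t : nat -> R) :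
  t k @[k --> \oo] --> (0 : R) <->
  forall e, 0 < e -> exists N : nat, forall k, (N <= k)%N -> `|t k| < e.
Proof.
split=> [t0 e e0|t0 P /nbhs_ballP[e /= e0 eP]].
  have /t0[N _ NP] : nbhs (0 : R) [set x | `|x| < e].
    apply/nbhs_ballP; exists e => // x; rewrite /ball /= sub0r normrN //.
  by exists N => k /NP.
have [N NP] := t0 _ e0; exists N => // k /= Nk; apply: eP.
by rewrite /ball /= sub0r normrN NP.
Qed.

Lemma invS_small (e : R) : 0 < e ->
  exists N : nat, forall k, (N <= k)%N -> (k.+1%:R^-1 : R) < e.
Proof.
move=> e0; have /cvg0_seqP/(_ e e0)[N NP] := @cvg_harmonic R.
by exists N => k /NP; rewrite /= ger0_norm // invr_ge0.
Qed.

Lemma lt_both (r r' : R) : 0 < r -> 0 < r' ->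
  exists t, [/\ 0 < t, t < r & t < r'].
Proof.
move=> r0 r'0; exists (Num.min (r / 2) (r' / 2)); split.
- by rewrite lt_min !divr_gt0.
- by apply: le_lt_trans (_ : r / 2 < _); rewrite ?ge_min ?lexx //; lra.
- by apply: le_lt_trans (_ : r' / 2 < _); rewrite ?ge_min ?lexx ?orbT //; lra.
Qed.

Lemma enorm_continuous n : continuous (@enorm R n).
Proof.
move=> x P /nbhs_ballP[e /= e0 eP]; apply/nbhs_enormP; exists e => // y xy.
apply: eP; rewrite /ball /=; apply: le_lt_trans xy.
rewrite ler_norml enormBC enorm_lerB andbT lerNl opprB enormBC.
exact: enorm_lerB.
Qed.

Lemma compact_eball n (B : R) : compact [set x : 'rV[R]_n | enorm x <= B].
Proof.
apply: bounded_closed_compact.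
  exists B; split; first by rewrite num_real.
  move=> M BM x /= xB; apply: le_trans (norm_le_enorm _) _.
  exact: le_trans xB (ltW BM).
apply: (@closed_comp _ _ (@enorm R n) [set x | x <= B]); last exact: closed_le.
by move=> x _; exact: enorm_continuous.
Qed.

(** Compactness in the form used below in place of subsequences. The conditions [P e] are not
    assumed closed, so the limit point need not satisfy them; it only has solutions of every [P e]
    arbitrarily near. *)
Lemma approx_cluster n (B : R) (P : R -> 'rV[R]_n -> Prop) :
  (forall e e' x, e <= e' -> P e x -> P e' x) ->
  (forall e, 0 < e -> exists2 x, enorm x <= B & P e x) ->
  exists2 x, enorm x <= B &
    forall e, 0 < e -> exists2 x', enorm (x' - x) < e & P e x'.
Proof.
move=> Pmono Pex.
pose F := filter_from [set e : R | 0 < e]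
  (fun e => [set x | enorm x <= B /\ P e x]).
have FF : ProperFilter F.
  apply: filter_from_proper; last by move=> e /Pex[x]; exists x.
  apply: filter_from_filter; first by exists 1 => /=.
  move=> e e' /= e0 e'0; exists (Num.min e e'); first by rewrite /= lt_min e0.
  move=> x [xB Px]; split; split=> //; apply: Pmono Px.
    by rewrite ge_min lexx.
  by rewrite ge_min lexx orbT.
have [|x [xB Fx]] := @compact_eball n B F FF.
  by exists 1 => //= x [].
exists x => // e e0.
have [||x' [[_ Px'] xx']] := Fx [set x | enorm x <= B /\ P e x]
  [set x' | enorm (x' - x) < e].
- by exists e.
- by apply/nbhs_enormP; exists e.
by exists x'.
Qed.

End euclidean.


(** * Second-order Taylor expansion in Euclidean norm *)

Section taylor.
Context {R : realType}.

Lemma enorm_le_coord n :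
  exists2 c : R, 0 < c & forall (x : 'rV[R]_n) e, 0 <= e ->
    (forall i, `|x 0 i| <= e) -> enorm x <= c * e.
Proof.
have [c c0 cP] := @enorm_le_norm R n; exists c => // x e e0 xe.
rewrite (le_trans (cP x)) // ler_pM2l //.
rewrite [leLHS]/Num.norm /= mx_normrE; apply/bigmax_leP; split=> // -[i j] _ /=.
by rewrite ord1 xe.
Qed.

Lemma differentiable_enorm n m (F : 'rV[R]_n -> 'rV[R]_m) x :
  differentiable F x -> forall e, 0 < e -> exists2 r, 0 < r &
    forall h, enorm h < r -> enorm (F (x + h) - F x - h *m 'J F x) <= e * enorm h.
Proof.
move=> dF e e0; have [c c0 cP] := @enorm_le_norm R m.
have [_ /eqaddoP/(_ (e / c))] := (diff_locallyP x F).1 dF.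
rewrite divr_gt0 // => /(_ isT) /nbhs_enormP[r r0 rP]; exists r => // h hr.
have {rP} := rP h; rewrite subr0 => /(_ hr) /= rP.
have -> : F (x + h) - F x - h *m 'J F x =
  ((F \o shift x - (cst (F x) + 'd F x)) h : 'rV[R]_m).
  rewrite /jacobian mul_rV_lin1 !fctE /= [h + x]addrC opprD addrA //.
rewrite (le_trans (cP _)) // -ler_pdivlMl // (le_trans rP) //.
rewrite mulrA [c^-1 * _]mulrC ler_wpM2l ?norm_le_enorm //.
by rewrite ltW // divr_gt0.
Qed.

Lemma is_derive_line n d (G : 'rV[R]_n -> 'rV[R]_d) x h i (t : R) :
  differentiable G (x + t *: h) ->
  is_derive t 1 (fun t : R => G (x + t *: h) 0 i)
    (dot h (grad_comp G i (x + t *: h))).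
Proof.
move=> dG; pose l := fun t : R => x + t *: h.
have dl : is_diff t l ( *:%R ^~ h).
  have -> : l = cst x + ( *:%R ^~ h) by apply/funext => s.
  rewrite -[X in is_diff _ _ X]add0r.
  exact: (is_diffD (is_diff_cst _ _) (is_diff_scalel _ _)).
have dGl : differentiable (G \o l) t by apply: differentiable_comp.
have D : derivable (G \o l) t 1 by exact: diff_derivable.
apply: DeriveDef; first by have /derivable_mxP := D; apply.
have /matrixP/(_ 0 i) := derive_mx D; rewrite !mxE => <-.
rewrite deriveE // diff_comp //= diff_val scale1r /dot.
have -> : 'd G (l t) h = h *m 'J G (l t) by rewrite /jacobian mul_rV_lin1.
by rewrite mxE; apply: eq_bigr => k _; rewrite !mxE.
Qed.

(* The mean value theorem is applied along the segment from [x] to [x + h] to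
   [G i] minus its quadratic Taylor polynomial. *)
Lemma taylor2_coord n d (G : 'rV[R]_n -> 'rV[R]_d) x i :
  twice_cont_diff G -> forall e, 0 < e -> exists2 r, 0 < r &
    forall h, enorm h < r ->
      `|(G (x + h) - G x - h *m 'J G x - 2^-1 *: hess_quad G x h) 0 i|
        <= e * enorm h ^+ 2.
Proof.
move=> [dG dH] e e0; have [dgi _] := dH i.
have [r r0 rP] := differentiable_enorm (dgi x) e0; exists r => // h hr.
pose a := dot h (grad_comp G i x).
pose b := dot h (h *m hess_comp G i x).
pose phi : R -> R := (fun t : R => G (x + t *: h) 0 i) - (a *: (@id R))
  - ((b / 2) *: ((@id R) ^+ 2 : R -> R)).
have dphi (t : R) : is_derive t 1 phi
    (dot h (grad_comp G i (x + t *: h)) - a - t * b).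
  have D := @is_derive_line n d G x h i t (dG _).
  apply: is_derive_eq.
  by rewrite /GRing.scale /= expr1 !mulr1; field.
have [c cI] : exists2 c, c \in `]0, 1[%R & phi 1 - phi 0 =
    (dot h (grad_comp G i (x + c *: h)) - a - c * b) * (1 - 0).
  apply: (@MVT R phi (fun t => dot h (grad_comp G i (x + t *: h)) - a - t * b)) => //.
  apply: continuous_subspaceT => t; apply: differentiable_continuous.
  by apply/derivable1_diffP; case: (dphi t).
have [c0 c1] : 0 < c /\ c < 1 by move: cI; rewrite in_itv /= => /andP[].
rewrite subr0 mulr1 => E.
have -> : (G (x + h) - G x - h *m 'J G x - 2^-1 *: hess_quad G x h) 0 i =
   phi 1 - phi 0.
  have -> : phi 1 - phi 0 = G (x + h) 0 i - G x 0 i - a - 2^-1 * b.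
    rewrite /phi !fctE scale1r scale0r addr0 /GRing.scale /=.
    by rewrite expr1n expr0n /=; field.
  rewrite !mxE -/b; congr (_ - _ - _).
  by apply: eq_bigr => k _; rewrite !mxE.
rewrite E.
(* The derivative of [phi] at [c] is [h] paired with the first-order remainder of the gradient at
   [c h]. The remainder is at most [e |h|], and the pairing supplies the second factor [|h|]. *)
have -> : dot h (grad_comp G i (x + c *: h)) - a - c * b =
  dot h (grad_comp G i (x + c *: h) - grad_comp G i x
     - (c *: h) *m 'J (grad_comp G i) x).
  by rewrite !dotBr -scalemxAl dotZr.
rewrite (le_trans (dot_abs_le _ _)) // expr2 mulrCA ler_wpM2l ?enorm_ge0 //.
have ch : enorm (c *: h) <= enorm h.
  by rewrite enormZ gtr0_norm // ler_piMl ?enorm_ge0 // ltW.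
rewrite (le_trans (rP _ _)) //; first exact: le_lt_trans hr.
by rewrite ler_pM2l.
Qed.

Lemma taylor2 n d (G : 'rV[R]_n -> 'rV[R]_d) x :
  twice_cont_diff G -> forall e, 0 < e -> exists2 r, 0 < r &
    forall h, enorm h < r ->
      enorm (G (x + h) - G x - h *m 'J G x - 2^-1 *: hess_quad G x h)
        <= e * enorm h ^+ 2.
Proof.
move=> G2 e e0; have [c c0 cP] := @enorm_le_coord d.
have ec0 : 0 < e / c by rewrite divr_gt0.
have /filter_forall : forall i, nbhs (0 : 'rV[R]_n) [set h |
  `|(G (x + h) - G x - h *m 'J G x - 2^-1 *: hess_quad G x h) 0 i|
        <= e / c * enorm h ^+ 2].
  move=> i; apply/nbhs_enormP.
  have [r r0 rP] := taylor2_coord x i G2 ec0; exists r => // h.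
  by rewrite subr0; exact: rP.
move=> /nbhs_enormP[r r0 rP]; exists r => // h hr.
have {}rP := rP h; rewrite subr0 in rP.
apply: le_trans (cP _ _ _ (rP hr)) _.
  by rewrite mulr_ge0 ?sqr_ge0 // ltW.
by rewrite mulrA [c * _]mulrC divfK // gt_eqF.
Qed.

Lemma hess_quadZ n d (G : 'rV[R]_n -> 'rV[R]_d) x t h :
  hess_quad G x (t *: h) = t ^+ 2 *: hess_quad G x h.
Proof. by apply/rowP => i; rewrite !mxE -scalemxAl dotZl dotZr mulrA. Qed.

Lemma hess_quad_near n d (G : 'rV[R]_n -> 'rV[R]_d) x u :
  forall e, 0 < e -> exists2 r, 0 < r &
    forall w, enorm (w - u) < r ->
      enorm (hess_quad G x w - hess_quad G x u) <= e.
Proof.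
move=> e e0; have [c c0 cP] := @enorm_le_coord d.
have ec0 : 0 < e / c by rewrite divr_gt0.
have /filter_forall : forall i, nbhs u [set w |
    `|(hess_quad G x w - hess_quad G x u) 0 i| <= e / c].
  move=> i; apply/nbhs_enormP.
  set H := hess_comp G i x; have [k k0 kP] := enorm_mulmx H.
  have N0 : 0 < k * (2 * enorm u + 1) + 1.
    by rewrite ltr_wpDl // mulr_ge0 // addr_ge0 // mulr_ge0 // enorm_ge0.
  (* The two halves of the splitting below are at most [k |w - u| (|u| + 1)] and [k |w - u| |u|]. *)
  exists (Num.min 1 ((e / c) / (k * (2 * enorm u + 1) + 1))).
    by rewrite lt_min ltr01 divr_gt0.
  move=> w; rewrite lt_min => /andP[w1 we] /=; rewrite !mxE -/H.
  have -> : dot w (w *m H) - dot u (u *m H) =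
    dot (w - u) (w *m H) + dot u ((w - u) *m H).
    by rewrite dotBl mulmxBl dotBr; ring.
  have wu : enorm w <= enorm u + 1.
    have := enorm_lerB w u; lra.
  apply: le_trans (ler_normD _ _) _.
  have B1 := le_trans (dot_abs_le (w - u) (w *m H))
    (ler_wpM2l (enorm_ge0 _) (kP w)).
  have B2 := le_trans (dot_abs_le u ((w - u) *m H))
    (ler_wpM2l (enorm_ge0 _) (kP (w - u))).
  move: we; rewrite ltr_pdivlMr // => we.
  have := enorm_ge0 (w - u); have := enorm_ge0 u.
  set a := enorm (w - u) in B1 B2 we *; set b := enorm u in B2 wu we N0 *.
  set f := enorm w in B1 wu.
  move=> b0 a0; have : a * (k * f) <= a * (k * (b + 1)).
    by rewrite ler_wpM2l // ler_wpM2l.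
  move: we; set K := e / c; nra.
move=> /nbhs_enormP[r r0 rP]; exists r => // w wr.
apply: le_trans (cP _ _ (ltW ec0) (rP _ wr)) _.
by rewrite mulrC divfK // gt_eqF.
Qed.

(* With [w = u + (t / 2) s] the argument is [x + t u + (t^2 / 2) s]. *)
Lemma taylor2_dir n d (G : 'rV[R]_n -> 'rV[R]_d) x u :
  twice_cont_diff G -> forall e, 0 < e -> exists2 r, 0 < r &
    forall t w, 0 < t -> t < r -> enorm (w - u) < r ->
      enorm (G (x + t *: w) - G x - t *: (w *m 'J G x)
             - (2^-1 * t ^+ 2) *: hess_quad G x u) <= e * t ^+ 2.
Proof.
move=> G2 e e0.
have [r1 r10 r1P] := hess_quad_near G x u e0.
pose b := enorm u + 1; have b0 : 0 < b by rewrite ltr_wpDl // enorm_ge0.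
(* Half of [e] pays for the Taylor remainder at [t w], where [|t w| <= t b]; the other half for
   replacing [hess_quad G x w] by its value at [u]. *)
have e'0 : 0 < e / 2 / b ^+ 2 by rewrite !divr_gt0 // exprn_gt0.
have [r2 r20 r2P] := taylor2 x G2 e'0.
exists (Num.min (Num.min 1 r1) (r2 / b)).
  by rewrite !lt_min ltr01 r10 divr_gt0.
move=> t w t0; rewrite !lt_min => /andP[_ tr2] /andP[/andP[w1 wr1] _].
have wb : enorm w <= b by have := enorm_lerB w u; rewrite /b; lra.
have tw : enorm (t *: w) <= t * b.
  by rewrite enormZ gtr0_norm // ler_pM2l.
have {r2P} := r2P (t *: w); have {r1P} := r1P w wr1.
rewrite hess_quadZ -scalemxAl scalerA => H1 H2.
have {}H2 := H2 (le_lt_trans tw _); move: tr2; rewrite ltr_pdivlMr // => tr2.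
have {H2}/le_trans H2 := H2 tr2.
rewrite (_ : _ - _ - _ - _ = (G (x + t *: w) - G x - t *: (w *m 'J G x)
  - (2^-1 * t ^+ 2) *: hess_quad G x w) +
  (2^-1 * t ^+ 2) *: (hess_quad G x w - hess_quad G x u)); last first.
  by rewrite scalerBr addrA subrK.
rewrite (le_trans (enormD _ _)) // enormZ ger0_norm; last first.
  by rewrite mulr_ge0 // sqr_ge0.
have -> : e * t ^+ 2 = e / 2 / b ^+ 2 * (t * b) ^+ 2 + 2^-1 * t ^+ 2 * e.
  by field; rewrite gt_eqF.
rewrite lerD //; last by rewrite ler_wpM2l // mulr_ge0 // sqr_ge0.
apply: H2; rewrite ler_pM2l // ler_pXn2r ?nnegrE ?enorm_ge0 //.
by rewrite mulr_ge0 // ltW.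
Qed.

End taylor.


(** * Polyhedral sets, their local cones, and normals to cones *)

Section polyhedra.
Context {R : realType}.

(* A list of pairs [(a, b)] encodes the system [dot a z <= b]; a list of such
   lists encodes a union. *)
Definition in_sys n (z : 'rV[R]_n) (s : seq ('rV[R]_n * R)) : bool :=
  all (fun ab => dot ab.1 z <= ab.2) s.

Definition poly_set n (ss : seq (seq ('rV[R]_n * R))) : set 'rV[R]_n :=
  [set z | has (in_sys z) ss].

Definition is_poly n (S : set 'rV[R]_n) : Prop := exists ss, S = poly_set ss.

(** Only positive multiples are required, so the empty set is a cone; it is the local cone of a
    polyhedral set at a point outside it. *)
Definition is_cone n (K : set 'rV[R]_n) : Prop :=
  forall t w, 0 < t -> K w -> K (t *: w).

Definition local_cone n (S : set 'rV[R]_n) z (K : set 'rV[R]_n) : Prop :=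
  exists2 r, 0 < r & forall w, enorm w < r -> S (z + w) <-> K w.

Lemma convex_polyhedral_sys n (S : set 'rV[R]_n) :
  convex_polyhedral S -> exists s, S = [set z | in_sys z s].
Proof.
move=> [m [H [hH ->]]].
have {hH}/choice[f fP] : forall i, exists ab : 'rV[R]_n * R,
    H i = [set z | dot ab.1 z <= ab.2].
  by move=> i; have [a [b [_ ->]]] := hH i; exists (a, b).
exists [seq f i | i <- enum 'I_m]; apply/seteqP; split=> z /=.
  by move=> Hz; apply/allP => _ /mapP[i _ ->]; have := Hz i I; rewrite fP.
move=> /allP Hz i _; rewrite fP; apply: Hz.
by rewrite map_f // mem_enum.
Qed.

Lemma polyhedral_is_poly n (S : set 'rV[R]_n) : polyhedral S -> is_poly S.
Proof.
move=> [m [P [hP ->]]].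
have /choice[f fP] : forall i, exists s, P i = [set z | in_sys z s].
  by move=> i; exact: convex_polyhedral_sys.
exists [seq f i | i <- enum 'I_m]; apply/seteqP; split=> z /=.
  move=> [i _]; rewrite fP => iz; apply/hasP; exists (f i) => //.
  by rewrite map_f // mem_enum.
by move=> /hasP[_ /mapP[i _ ->] iz]; exists i => //; rewrite fP.
Qed.

(** Inactive constraints have slack and survive small moves; an active one loses its constant term
    and becomes homogeneous in [w]. *)
Lemma in_sys_local n (z : 'rV[R]_n) (s : seq ('rV[R]_n * R)) : in_sys z s ->
  exists2 r, 0 < r & forall w, enorm w < r ->
    in_sys (z + w) s =
    in_sys w [seq (ab.1, 0) | ab <- s & dot ab.1 z == ab.2].
Proof.
elim: s => [_|[a b] s IH /= /andP[]]; first by exists 1.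
rewrite /= le_eqVlt => /orP[/eqP az|azb] /IH[r r0 rP].
  exists r => // w wr; rewrite az eqxx /= rP // dotDr az.
  by rewrite gerDl.
(* The slack divided by the norm of [a], by Cauchy-Schwarz; adding [1] covers [a = 0]. *)
exists (Num.min r ((b - dot a z) / (enorm a + 1))).
  by rewrite lt_min r0 divr_gt0 ?subr_gt0 ?enorm1_gt0.
move=> w; rewrite lt_min => /andP[wr].
rewrite ltr_pdivlMr ?enorm1_gt0 // => wab.
rewrite (lt_eqF azb) rP // dotDr.
have -> : dot a z + dot a w <= b by have := dot_le a w; have := enorm_ge0 w; nra.
by [].
Qed.

Lemma notin_sys_local n (z : 'rV[R]_n) (s : seq ('rV[R]_n * R)) : ~~ in_sys z s ->
  exists2 r, 0 < r & forall w, enorm w < r -> ~~ in_sys (z + w) s.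
Proof.
move=> /allPn[[a b] /= abs]; rewrite -ltNge => azb.
exists ((dot a z - b) / (enorm a + 1)).
  by rewrite divr_gt0 ?subr_gt0 ?enorm1_gt0.
move=> w; rewrite ltr_pdivlMr ?enorm1_gt0 // => wab.
apply/allPn; exists (a, b) => //=; rewrite -ltNge dotDr.
have := dot_abs_le a w; rewrite ler_norml => /andP[+ _].
have := enorm_ge0 w; nra.
Qed.

(** Pieces that miss [z] miss a ball around it and are dropped; the others contribute their active
    constraints. *)
Lemma is_poly_local_cone n (S : set 'rV[R]_n) z : is_poly S ->
  exists K, [/\ is_poly K, is_cone K & local_cone S z K].
Proof.
move=> [ss ->].
pose lc (s : seq ('rV[R]_n * R)) := [seq (ab.1, 0 : R) | ab <- s & dot ab.1 z == ab.2].
exists (poly_set [seq lc s | s <- ss & in_sys z s]); split.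
- by exists [seq lc s | s <- ss & in_sys z s].
- move=> t w t0 /hasP[_ /mapP[s sz ->] /allP sw].
  apply/hasP; exists (lc s); first by rewrite map_f.
  apply/allP => _ /mapP[ab abs ->] /=; rewrite dotZr pmulr_rle0 //.
  by apply: (sw (ab.1, 0)); rewrite map_f.
- elim: ss => [|s ss [r r0 rP]]; first by exists 1.
  have [zs|zs] := boolP (in_sys z s).
    have [r' r'0 r'P] := in_sys_local zs.
    exists (Num.min r r'); first by rewrite lt_min r0.
    move=> w; rewrite lt_min => /andP[wr wr']; rewrite /poly_set /= zs /= r'P //.
    split=> /orP[->//|]; move/(rP _ wr); rewrite /poly_set /= => ->; exact: orbT.
  have [r' r'0 r'P] := notin_sys_local zs.
  exists (Num.min r r'); first by rewrite lt_min r0.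
  move=> w; rewrite lt_min => /andP[wr wr']; rewrite /poly_set /= (negbTE zs).
  by rewrite (negbTE (r'P _ wr')) /=; exact: rP.
Qed.

Lemma is_poly_closed n (S : set 'rV[R]_n) z : is_poly S ->
  (forall e, 0 < e -> exists2 x, enorm (x - z) < e & S x) -> S z.
Proof.
move=> [ss ->] zS; apply: contrapT => /negP/hasPn ssz.
have [r r0 rP] : exists2 r, 0 < r & forall w, enorm w < r -> ~ poly_set ss (z + w).
  elim: ss ssz {zS} => [_|s ss IH ssz]; first by exists 1.
  have /IH[r1 r10 r1P] : forall s, s \in ss -> ~~ in_sys z s.
    by move=> s' ss'; apply: ssz; rewrite inE ss' orbT.
  have /notin_sys_local[r2 r20 r2P] := ssz s (mem_head _ _).
  exists (Num.min r1 r2); first by rewrite lt_min r10.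
  move=> w; rewrite lt_min => /andP[wr1 wr2]; rewrite /poly_set /=.
  by rewrite (negbTE (r2P _ wr2)) /=; exact: r1P.
have [x xz Sx] := zS r r0; apply: (rP (x - z)) => //.
by rewrite subrKC.
Qed.

(** The pulled-back vectors [a *m A^T] may vanish, which [in_sys] tolerates although [halfspace]
    does not. *)
Lemma is_poly_affine_preimage n d (A : 'M[R]_(n, d)) (h : 'rV[R]_d) S :
  is_poly S -> is_poly [set s | S (s *m A + h)].
Proof.
move=> [ss ->].
exists [seq [seq (ab.1 *m A^T, ab.2 - dot ab.1 h) | ab <- s] | s <- ss].
apply/funext => z; rewrite /poly_set /= has_map; congr (is_true _).
apply: eq_has => s; rewrite /in_sys /= all_map; apply: eq_all => -[a b] /=.
by rewrite dotDr dotC dot_mulmx dotC lerBrDr.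
Qed.

Lemma local_coneT n (S : set 'rV[R]_n) z K : local_cone S z K -> S z <-> K 0.
Proof.
by move=> [r r0 /(_ 0)]; rewrite enorm0 addr0; apply.
Qed.

Lemma scale_small n (w : 'rV[R]_n) r : 0 < r ->
  exists2 t, 0 < t & forall t', `|t'| <= t -> enorm (t' *: w) < r.
Proof.
move=> r0; have w0 := enorm1_gt0 w.
have rw0 : 0 < r / (enorm w + 1) by rewrite divr_gt0.
exists (r / (enorm w + 1)) => // t' H; rewrite enormZ.
apply: le_lt_trans (ler_wpM2r (enorm_ge0 w) H) _.
by rewrite mulrAC ltr_pdivrMr // ltr_pM2l // ltrDl.
Qed.

Lemma tangent_cone_local n (S : set 'rV[R]_n) z K :
  is_poly K -> is_cone K -> local_cone S z K -> tangent_cone S z = K.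
Proof.
move=> Kp Kc [r r0 rP]; apply/seteqP; split=> w.
  move=> [t [v [t0 /cvg0_seqP tc /cvg_enormP vc Sv]]].
  apply: (is_poly_closed Kp) => e e0.
  have [N1 N1P] := vc _ e0.
  have [N2 N2P] := vc _ ltr01.
  have b0 := enorm1_gt0 w.
  have [|N3 N3P] := tc (r / (enorm w + 1)); first by rewrite divr_gt0.
  pose k := maxn N1 (maxn N2 N3); exists (v k); first by rewrite N1P ?leq_maxl.
  have tk := t0 k.
  have vk : enorm (v k) < enorm w + 1.
    have := N2P k; rewrite leq_max leq_max leqnn orbT => /(_ isT).
    have := enorm_lerB (v k) w; lra.
  have tvr : enorm (t k *: v k) < r.
    have := N3P k; rewrite !leq_max leqnn !orbT => /(_ isT).
    rewrite ltr_pdivlMr ?enorm1_gt0 // enormZ; have := normr_ge0 (t k); nra.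
  have : K (t k *: v k) by apply/rP.
  have tk' : 0 < (t k)^-1 by rewrite invr_gt0.
  by move=> /(Kc _ _ tk'); rewrite scalerA mulVf ?scale1r // gt_eqF.
move=> Kw; have [t t0 tP] := scale_small w r0.
exists (fun k => t / k.+1%:R), (fun=> w); split.
- by move=> k; rewrite divr_gt0.
- rewrite -(mulr0 t); apply: cvgM; [exact: cvg_cst|exact: cvg_harmonic].
- exact: cvg_cst.
- move=> k; apply/rP.
    apply: tP; rewrite gtr0_norm ?divr_gt0 //.
    by rewrite ler_pdivrMr // ler_peMr ?(ltW t0) ?ler1n.
  by apply: Kc => //; rewrite divr_gt0.
Qed.

Lemma le0_of_le_eps (a b : R) : 0 <= b -> (forall e, 0 < e -> a <= e * b) -> a <= 0.
Proof.
move=> b0 H; rewrite leNgt; apply/negP => a0.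
have := H (a / (b + b + 1)); rewrite divr_gt0 ?ltr_wpDl ?addr_ge0 // => /(_ isT).
rewrite mulrAC ler_pdivlMr ?ltr_wpDl ?addr_ge0 //.
have : 0 < a * (b + 1) by rewrite mulr_gt0 // ltr_wpDl.
nra.
Qed.

Lemma regular_normal_local_polar n (S : set 'rV[R]_n) z K y :
  is_cone K -> local_cone S z K -> regular_normal S z y ->
  forall w, K w -> dot y w <= 0.
Proof.
move=> Kc [r r0 rP] [_ Ny] w Kw.
apply: (@le0_of_le_eps _ (enorm w)); first exact: enorm_ge0.
move=> e e0; have /nbhs_enormP[r' r'0 r'P] := Ny e e0.
have [|t t0 tP] := @scale_small _ w (Num.min r r'); first by rewrite lt_min r0.
have := tP t; rewrite gtr0_norm // lexx lt_min => /(_ isT)/andP[tr tr'].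
have Szt : S (z + t *: w) by apply/rP => //; exact: Kc.
have := r'P (z + t *: w); rewrite addrC addKr => /(_ tr' Szt).
by rewrite dotZr enormZ gtr0_norm // mulrCA ler_pM2l.
Qed.

Lemma polar_regular_normal n (S : set 'rV[R]_n) z K y :
  local_cone S z K -> S z -> (forall w, K w -> dot y w <= 0) ->
  regular_normal S z y.
Proof.
move=> [r r0 rP] Sz Ky; split=> // e e0; apply/nbhs_enormP; exists r => // x xz Sx.
apply: (@le_trans _ _ 0); last by rewrite mulr_ge0 ?enorm_ge0 // ltW.
by apply: Ky; apply/rP => //; rewrite subrKC.
Qed.

(* Both [p + t p] and [p - t p] belong to the cone for small [t]. *)
Lemma regular_normal_cone_orth n (K : set 'rV[R]_n) p y :
  is_cone K -> regular_normal K p y -> dot y p = 0.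
Proof.
move=> Kc [Kp Ny]; apply/eqP; rewrite eq_le.
have H s : `|s| = 1 -> s * dot y p <= 0.
  move=> s1; apply: (@le0_of_le_eps _ (enorm p)); first exact: enorm_ge0.
  move=> e e0; have /nbhs_enormP[r r0 rP] := Ny e e0.
  have [t t0 tP] := scale_small p r0.
  (* The bound [1 / 2] keeps the factor [1 + s t'] positive, as [is_cone] requires. *)
  pose t' := Num.min t 2^-1; have t'0 : 0 < t' by rewrite lt_min t0 /=.
  have t'h : t' <= 2^-1 by rewrite ge_min lexx orbT.
  have st : `|s * t'| = t' by rewrite normrM s1 mul1r gtr0_norm.
  have := tP (s * t'); rewrite st ge_min lexx => /(_ isT) sr.
  have := rP ((1 + s * t') *: p).
  have -> : (1 + s * t') *: p - p = (s * t') *: p.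
    by rewrite scalerDl scale1r addrC addKr.
  move=> /(_ sr); rewrite dotZr enormZ st => H.
  rewrite -(ler_pM2l t'0) !mulrA [t' * s]mulrC [t' * e]mulrC -[leRHS]mulrA.
  apply: H; apply: Kc => //.
  have : `|s * t'| < 1 by rewrite st; lra.
  rewrite ltr_norml; lra.
have := H 1; rewrite normr1 mul1r => /(_ erefl) ->.
by have := H (-1); rewrite normrN normr1 mulN1r oppr_le0 => /(_ erefl) ->.
Qed.

(** A regular normal to a cone at [p] is one at [t p] for every [t > 0], and near [v] the set [C] is
    [v + K]. A small [t] brings the base point within [e] of [v], however large [p] is. *)
Lemma regular_normal_cone_transfer n (C K : set 'rV[R]_n) v p y :
  is_cone K -> local_cone C v K -> regular_normal K p y ->
  forall e, 0 < e -> exists2 x, enorm (x - v) < e & regular_normal C x y.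
Proof.
move=> Kc [r r0 rP] [Kp Ny] e e0.
have [|t t0 tP] := @scale_small _ p (Num.min (r / 2) e).
  by rewrite lt_min e0 divr_gt0.
have := tP t; rewrite gtr0_norm // lexx lt_min => /(_ isT)/andP[tr te].
have vtp : v + t *: p - v = t *: p by rewrite addrC addKr.
exists (v + t *: p); first by rewrite vtp.
have Ct : C (v + t *: p) by apply/rP; [lra|exact: Kc].
split=> // e' e'0; have /nbhs_enormP[r' r'0 r'P] := Ny e' e'0.
(* The radius [r / 2] keeps [x] where [C] is [v + K]; the radius [t r'] becomes [r'] after division
   by [t]. *)
have m0 : 0 < Num.min (r / 2) (t * r') by rewrite lt_min !(divr_gt0, mulr_gt0).
apply/nbhs_enormP; exists (Num.min (r / 2) (t * r')) => // x.
rewrite lt_min => /andP[xr xr'] Cx.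
have xv : enorm (x - v) < r.
  by have := enorm_distD (v + t *: p) x v; rewrite vtp; lra.
have Kx : K (x - v) by apply/rP => //; rewrite subrKC.
have ti : 0 < t^-1 by rewrite invr_gt0.
have tn0 : t != 0 by rewrite gt_eqF.
have E : x - (v + t *: p) = t *: (t^-1 *: (x - v) - p).
  by rewrite scalerBr scalerA mulfV // scale1r opprD addrA.
have := r'P (t^-1 *: (x - v)); move: xr'; rewrite E !enormZ gtr0_norm // ltr_pM2l //.
move=> xr' /(_ xr' (Kc _ _ ti Kx)).
by rewrite dotZr mulrCA ler_pM2l.
Qed.

(** Since base points can be scaled towards [v], no control on the points [p] is required. *)
Lemma limiting_normal_closure n (C K : set 'rV[R]_n) v y :
  is_cone K -> local_cone C v K -> C v ->
  (forall e, 0 < e -> exists2 y', enorm (y' - y) < e &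
     exists p, regular_normal K p y') ->
  limiting_normal C v y.
Proof.
move=> Kc CK Cv H; split=> //.
have /choice[f fP] : forall k : nat, exists xy : 'rV[R]_n * 'rV[R]_n,
    [/\ enorm (xy.1 - v) < k.+1%:R^-1, enorm (xy.2 - y) < k.+1%:R^-1 &
      regular_normal C xy.1 xy.2].
  move=> k; have k0 : 0 < (k.+1%:R^-1 : R) by rewrite invr_gt0.
  have [y' yy' [p Np]] := H _ k0.
  have [x xv Nx] := regular_normal_cone_transfer Kc CK Np k0.
  by exists (x, y').
exists (fun k => (f k).1), (fun k => (f k).2); split.
- apply/cvg_enormP => e /invS_small[N NP]; exists N => k /NP; apply: lt_trans.
  by have [] := fP k.
- by move=> k; have [_ _ []] := fP k.
- apply/cvg_enormP => e /invS_small[N NP]; exists N => k /NP; apply: lt_trans.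
  by have [] := fP k.
- by move=> k; have [] := fP k.
Qed.

(** A polyhedral set is conical near [z], so the [o] term vanishes on a whole ball. This is what
    makes an exact penalty possible. *)
Lemma regular_normal_poly n (M : set 'rV[R]_n) z x :
  is_poly M -> regular_normal M z x ->
  exists2 r, 0 < r & forall s, enorm (s - z) < r -> M s -> dot x (s - z) <= 0.
Proof.
move=> Mp Nx; have [K [_ Kc MK]] := is_poly_local_cone z Mp.
have {}Nx := regular_normal_local_polar Kc MK Nx.
case: MK => r r0 rP; exists r => // s sr Ms; apply: Nx.
by apply/rP => //; rewrite subrKC.
Qed.

End polyhedra.


(** * Closedness and compactness for optimisation over polyhedral sets *)

Section compact_minima.
Context {R : realType}.

Lemma is_poly_topclosed n (S : set 'rV[R]_n) : is_poly S -> closed S.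
Proof.
move=> Sp z zS; apply: (is_poly_closed Sp) => e e0.
have [|x [Sx xz]] := zS [set x | enorm (x - z) < e]; last by exists x.
by apply/nbhs_enormP; exists e.
Qed.

Lemma mulmxr_continuous n d (A : 'M[R]_(n, d)) :
  continuous (fun x : 'rV[R]_n => x *m A).
Proof.
have [c c0 cP] := enorm_mulmx A.
move=> x P /nbhs_enormP[e e0 eP]; apply/nbhs_enormP.
have c1 : 0 < c + 1 by rewrite ltr_wpDl.
exists (e / (c + 1)); first by rewrite divr_gt0.
move=> y; rewrite ltr_pdivlMr // => yx; apply: eP; rewrite -mulmxBl.
by apply: le_lt_trans (cP _) _; have := enorm_ge0 (y - x); nra.
Qed.

Lemma dot_continuous n (x : 'rV[R]_n) : continuous (dot x).
Proof.
have -> : dot x = (fun M : 'rV[R]_1 => M 0 0) \o (fun y => y *m x^T).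
  by apply/funext => y; rewrite dotC dotE.
move=> y; apply: continuous_comp; first exact: mulmxr_continuous.
exact: coord_continuous.
Qed.

Lemma compact_poly_ball n (S : set 'rV[R]_n) z r :
  is_poly S -> compact (S `&` [set x | enorm (x - z) <= r]).
Proof.
move=> Sp; apply: (@subclosed_compact _ _ [set x | enorm x <= r + enorm z]).
- apply: closedI; first exact: is_poly_topclosed.
  have -> : [set x : 'rV[R]_n | enorm (x - z) <= r] =
    (fun x => enorm (x - z)) @^-1` [set t : R | t <= r] by [].
  apply: preimage_closed; last exact: closed_le.
  move=> x _; apply: continuous_comp; last exact: enorm_continuous.
  by apply: (@continuousB _ _ _ id (cst z)); [exact: cvg_id|exact: cst_continuous].
- exact: compact_eball.
- by move=> x [_ /= xz]; have := enorm_lerB x z; lra.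
Qed.

End compact_minima.

(** * First-order conditions for a smoothed penalty problem *)

Section multipliers.
Context {R : realType} {n d : nat}.
Variables (A : 'M[R]_(n, d)) (h : 'rV[R]_d) (K : set 'rV[R]_d).

Let M := [set s : 'rV[R]_n | K (s *m A + h)].

(** An upper approximation of the norm that is smooth at [r = 0], the residual of the exact solution
    of the penalised problem. *)
Definition smooth_norm (e : R) (r : 'rV[R]_d) : R :=
  Num.sqrt (enorm r ^+ 2 + e ^+ 2).

(** A quadratic upper model that replaces differentiation. It is the inequality
    [2 psi(r) psi(r') <= psi(r)^2 + psi(r')^2], whose right side is polynomial in [r] and [r']. *)
Lemma smooth_norm_le (e : R) (r r' : 'rV[R]_d) : 0 < e ->
  smooth_norm e r' <= smooth_norm e r + dot r (r' - r) / smooth_norm e r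
    + enorm (r' - r) ^+ 2 / (2 * smooth_norm e r).
Proof.
move=> e0; set psi := smooth_norm e.
have psi2 x : psi x ^+ 2 = enorm x ^+ 2 + e ^+ 2.
  by rewrite sqr_sqrtr // addr_ge0 // sqr_ge0.
have p0 x : 0 < psi x by rewrite sqrtr_gt0 ltr_wpDl ?sqr_ge0 // exprn_gt0.
have E : enorm r' ^+ 2 = enorm r ^+ 2 + 2 * dot r (r' - r) + enorm (r' - r) ^+ 2.
  by rewrite !sqr_enorm dotBr dotBl !dotBr (dotC r' r); ring.
have P := p0 r; have P' := p0 r'.
have -> : psi r + dot r (r' - r) / psi r + enorm (r' - r) ^+ 2 / (2 * psi r) =
  (psi r ^+ 2 + psi r' ^+ 2) / (2 * psi r).
  have -> : psi r' ^+ 2 = psi r ^+ 2 + 2 * dot r (r' - r) + enorm (r' - r) ^+ 2.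
    by rewrite !psi2 E; ring.
  by field; rewrite gt_eqF.
rewrite ler_pdivlMr ?mulr_gt0 //.
have := sqr_ge0 (psi r' - psi r); nra.
Qed.

(* The penalised problem [min c |s A + h - p| - <x, s>] over [p in K] is solved
   by [(z, z A + h)]; smoothing the norm and adding a proximal term yields nearby
   minimisers at which the first-order conditions can be written down. *)
Lemma penalty_multiplier (c : R) x z :
  is_poly K -> 0 <= c -> M z ->
  (exists2 r, 0 < r & forall s p, enorm (s - z) < r -> K p ->
     dot x (s - z) <= c * enorm (s *m A + h - p)) ->
  forall e, 0 < e -> exists y p, [/\ regular_normal K p y,
    enorm (y *m A^T - x) <= e, enorm y <= c + e & enorm (p - (z *m A + h)) <= e].
Proof.
move=> Kp c0 Mz [r0 r00 pen] e e0.
have [a a0 aP] := enorm_mulmx A.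
have [b b0 bP] := enorm_mulmx A^T.
set pb := z *m A + h.
(* The proximal terms will disturb the multiplier equation by at most [2 r + 2 b r]. *)
pose r := Num.min (r0 / 2) (e / (2 * b + 2)).
have r_gt0 : 0 < r.
  by rewrite lt_min !divr_gt0 // ltr_wpDl // mulr_ge0.
have rr0 : r < r0.
  by apply: le_lt_trans (_ : r0 / 2 < _); rewrite ?ge_min ?lexx //; lra.
have re : r * (2 * b + 2) <= e.
  by rewrite -ler_pdivlMr ?ge_min ?lexx ?orbT // ltr_wpDl // mulr_ge0.
(* This smoothing gives the function [f] below the value [c d0 < r^2] at [(z, pb)]. By [pen] the
   other terms of [f] are together nonnegative, so the proximal terms of a minimiser are below [r^2]
   and it lies inside both balls. *)
pose d0 := r ^+ 2 / (2 * (c + 1)).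
have c1 : 0 < 2 * (c + 1) by rewrite mulr_gt0 // ltr_wpDl.
have d00 : 0 < d0 by rewrite divr_gt0 // exprn_gt0.
have cd : c * d0 < r ^+ 2.
  have : d0 * (2 * (c + 1)) = r ^+ 2 by rewrite /d0 divfK // gt_eqF.
  nra.
set psi := smooth_norm d0.
pose f (sp : 'rV[R]_n * 'rV[R]_d) := c * psi (sp.1 *m A + h - sp.2)
  - dot x (sp.1 - z) + enorm (sp.1 - z) ^+ 2 + enorm (sp.2 - pb) ^+ 2.
have cf : continuous f.
  have c1z sp : {for sp, continuous (fun sp : 'rV[R]_n * 'rV[R]_d => sp.1 - z)}.
    by apply: cvgB; [exact: cvg_fst|exact: cvg_cst].
  have c2p sp : {for sp, continuous (fun sp : 'rV[R]_n * 'rV[R]_d => sp.2 - pb)}.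
    by apply: cvgB; [exact: cvg_snd|exact: cvg_cst].
  have cr sp : {for sp, continuous (fun sp : 'rV[R]_n * 'rV[R]_d =>
      sp.1 *m A + h - sp.2)}.
    apply: cvgB; last exact: cvg_snd.
    apply: cvgD; last exact: cvg_cst.
    by apply: (@cvg_comp _ _ _ fst (fun s => s *m A)); [exact: cvg_fst|exact: mulmxr_continuous].
  have sq (T : topologicalType) m (g : T -> 'rV[R]_m) t : {for t, continuous g} ->
      {for t, continuous (fun t => enorm (g t) ^+ 2)}.
    move=> cg; apply: (@continuous_comp _ _ _ (fun t => enorm (g t)) (fun x => x ^+ 2)).
      by apply: continuous_comp => //; exact: enorm_continuous.
    exact: exprn_continuous.
  move=> sp; apply: cvgD; last exact: (sq _ _ _ _ (c2p sp)).
  apply: cvgD; last exact: (sq _ _ _ _ (c1z sp)).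
  apply: cvgB; last first.
    apply: (@continuous_comp _ _ _ (fun sp : 'rV[R]_n * 'rV[R]_d => sp.1 - z) (dot x) sp (c1z sp)).
    exact: dot_continuous.
  apply: cvgM; first exact: cvg_cst.
  apply: (@continuous_comp _ _ _ (fun sp : 'rV[R]_n * 'rV[R]_d =>
    enorm (sp.1 *m A + h - sp.2) ^+ 2 + d0 ^+ 2) Num.sqrt); last exact: sqrt_continuous.
  by apply: cvgD; [exact: (sq _ _ _ _ (cr sp))|exact: cvg_cst].
pose B1 := setT `&` [set s : 'rV[R]_n | enorm (s - z) <= r].
pose B2 := K `&` [set p | enorm (p - pb) <= r].
have cB : compact (B1 `*` B2).
  apply: compact_setX; apply: compact_poly_ball => //.
  by exists [:: [::]]; apply/seteqP; split.
have zB : (B1 `*` B2) (z, pb).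
  by split; split=> //=; rewrite subrr enorm0 ltW.
have [||[s p] /set_mem[/= [_ /= sz] [/= pK pz]] fmin] :=
  @compact_EVT_min _ R f _ _ cB.
- by exists (z, pb).
- by apply: continuous_subspaceT => sp; exact: cf.
have psi2 q : psi q ^+ 2 = enorm q ^+ 2 + d0 ^+ 2.
  by rewrite sqr_sqrtr // addr_ge0 // sqr_ge0.
have psi0 q : 0 < psi q by rewrite sqrtr_gt0 ltr_wpDl ?sqr_ge0 // exprn_gt0.
have psile q : enorm q <= psi q.
  by rewrite -(@ler_pXn2r _ 2) ?nnegrE ?enorm_ge0 ?(ltW (psi0 _)) // psi2 lerDl sqr_ge0.
have fz : f (z, pb) = c * d0.
  rewrite /f /= !subrr dot0r enorm0 expr0n /= subr0 !addr0 /psi /smooth_norm enorm0 expr0n add0r.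
  by rewrite sqrtr_sqr gtr0_norm //= !addr0.
have fs : enorm (s - z) ^+ 2 + enorm (p - pb) ^+ 2 < r ^+ 2.
  apply: le_lt_trans cd; rewrite -fz; apply: le_trans (fmin _ (mem_set zB)).
  rewrite /f /= -[leRHS]addrA lerDr.
  have := pen s p (le_lt_trans sz rr0) pK.
  by have := ler_wpM2l c0 (psile (s *m A + h - p)); lra.
have sz' : enorm (s - z) < r.
  rewrite -(@ltr_pXn2r _ 2) ?nnegrE ?enorm_ge0 ?(ltW r_gt0) //.
  by have := sqr_ge0 (enorm (p - pb)); lra.
have pz' : enorm (p - pb) < r.
  rewrite -(@ltr_pXn2r _ 2) ?nnegrE ?enorm_ge0 ?(ltW r_gt0) //.
  by have := sqr_ge0 (enorm (s - z)); lra.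
set q := s *m A + h - p; have qp := psi0 q.
(* At the minimiser, [g] is the partial gradient of [f] in [s], and [- y] the one in [p]. *)
pose y0 := (c / psi q) *: q.
pose y := y0 - 2 *: (p - pb).
pose g := y0 *m A^T - x + 2 *: (s - z).
(* Minimality with the smoothed norm replaced by its quadratic model: a first-order condition with
   explicit second-order error. *)
have key s' p' : enorm (s' - z) <= r -> enorm (p' - pb) <= r -> K p' ->
  0 <= dot g (s' - s) - dot y (p' - p) +
    c / (2 * psi q) * enorm ((s' - s) *m A - (p' - p)) ^+ 2
    + enorm (s' - s) ^+ 2 + enorm (p' - p) ^+ 2.
  move=> s'z p'z Kp'; have := fmin (s', p'); rewrite mem_set //.
  move=> /(_ isT); rewrite /f /= -/q -/pb.
  have := smooth_norm_le q (s' *m A + h - p') d00; rewrite -/psi.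
  have -> : s' *m A + h - p' - q = (s' - s) *m A - (p' - p).
    rewrite /q mulmxBl; set a1 := s' *m A; set a2 := s *m A.
    by apply/rowP => i; rewrite !mxE; ring.
  set ds := s' - s; set dp := p' - p.
  move=> /(ler_wpM2l c0) S1.
  have E1 : enorm (s' - z) ^+ 2 = enorm (s - z) ^+ 2 + 2 * dot (s - z) ds + enorm ds ^+ 2.
    rewrite !sqr_enorm /ds !(dotBl, dotBr) (dotC s' s) (dotC z s) (dotC z s'); ring.
  have E2 : enorm (p' - pb) ^+ 2 = enorm (p - pb) ^+ 2 + 2 * dot (p - pb) dp + enorm dp ^+ 2.
    rewrite !sqr_enorm /dp !(dotBl, dotBr) (dotC p' p) (dotC pb p) (dotC pb p'); ring.
  have E3 : dot x (s' - z) = dot x (s - z) + dot x ds by rewrite /ds !dotBr; ring.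
  rewrite E1 E2 E3 => H.
  have G1 : dot g ds = c / psi q * dot q (ds *m A) - dot x ds + 2 * dot (s - z) ds.
    rewrite /g (dotDl (_ - _)) (dotBl (_ *m _)) dotZl /y0 -scalemxAl dotZl.
    by rewrite (dotC (q *m _)) -dot_mulmx (dotC q).
  have G2 : dot y dp = c / psi q * dot q dp - 2 * dot (p - pb) dp.
    by rewrite /y /y0 dotBl !dotZl.
  have G3 : c * (psi q + dot q (ds *m A - dp) / psi q +
      enorm (ds *m A - dp) ^+ 2 / (2 * psi q)) = c * psi q + c / psi q * dot q (ds *m A)
      - c / psi q * dot q dp + c / (2 * psi q) * enorm (ds *m A - dp) ^+ 2.
    by rewrite dotBr; field; rewrite gt_eqF.
  rewrite G3 in S1; rewrite G1 G2; lra.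
set C0 := c / (2 * psi q) in key.
have C00 : 0 <= C0 by rewrite divr_ge0 // mulr_ge0 // ltW.
have g0 : g = 0.
  (* A step [- t' g] stays in the ball, and [t' C <= 1 / 2] keeps the quadratic error within half of
     the decrease [t' |g|^2], so minimality forces [g = 0]. *)
  pose C := C0 * a ^+ 2 + 1.
  have C_gt0 : 0 < C by rewrite ltr_wpDl // mulr_ge0 // sqr_ge0.
  have [|t t0 tP] := @scale_small _ _ g (r - enorm (s - z)); first by rewrite subr_gt0.
  pose t' := Num.min t (2 * C)^-1.
  have t'0 : 0 < t' by rewrite lt_min t0 invr_gt0 mulr_gt0.
  have t'C : t' * C <= 2^-1.
    have : t' <= (2 * C)^-1 by rewrite ge_min lexx orbT.
    move=> t'2; rewrite (_ : 2^-1 = (2 * C)^-1 * C) ?ler_pM2r //.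
    by field; rewrite gt_eqF.
  have t't : `|- t'| <= t by rewrite normrN gtr0_norm // ge_min lexx.
  have k1 : enorm (s + - t' *: g - z) <= r.
    by rewrite addrAC; have := enormD (s - z) (- t' *: g); have := tP _ t't; lra.
  have := key _ _ k1 (ltW pz') pK.
  rewrite [s + _]addrC addrK subrr dot0r !subr0 enorm0 expr0n addr0.
  rewrite dotZr -sqr_enorm enormZ normrN gtr0_norm // -scalemxAl enormZ normrN gtr0_norm // !exprMn.
  have gA : enorm (g *m A) ^+ 2 <= a ^+ 2 * enorm g ^+ 2.
    by rewrite -exprMn ler_pXn2r ?nnegrE ?enorm_ge0 ?mulr_ge0 ?enorm_ge0.
  move=> H; apply: enorm_eq0; apply/eqP; rewrite -sqrf_eq0.
  have N0 := sqr_ge0 (enorm g); rewrite eq_le N0 andbT.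
  have H1 : 0 <= t' * (- enorm g ^+ 2 + t' * C * enorm g ^+ 2).
    apply: le_trans H _.
    have := ler_wpM2l C00 (ler_wpM2l (sqr_ge0 t') gA).
    rewrite /C; lra.
  move: H1; rewrite pmulr_rge0 //.
  have := ler_wpM2r N0 t'C; lra.
have yA : y *m A^T - x = - (2 *: (s - z) + 2 *: ((p - pb) *m A^T)).
  have -> : y *m A^T = y0 *m A^T - 2 *: ((p - pb) *m A^T).
    by rewrite [LHS]mulmxBl (scalemxAl 2).
  move: g0; rewrite /g; set y1 := y0 *m A^T; set p1 := (p - pb) *m A^T.
  by move=> /rowP g0; apply/rowP => i; have := g0 i; rewrite !mxE; lra.
have r2 : 2 * r <= e by have := mulr_ge0 (ltW r_gt0) b0; lra.
exists y, p; split.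
(* For [s' = s], [key] reads [dot y (p' - p) <= (C0 + 1) |p' - p|^2] for [p'] in [K] near [p]. *)
- split=> // e' e'0; apply/nbhs_enormP.
  have C1 : 0 < C0 + 1 by rewrite ltr_wpDl.
  exists (Num.min (r - enorm (p - pb)) (e' / (C0 + 1))).
    by rewrite lt_min subr_gt0 pz' divr_gt0.
  move=> p'; rewrite lt_min => /andP[p'r]; rewrite ltr_pdivlMr // => p'e Kp'.
  have := key s p' (ltW sz') _ Kp'.
  have -> : enorm (p' - pb) <= r by have := enorm_distD p p' pb; lra.
  move=> /(_ isT); rewrite subrr dot0r mul0mx !sub0r enorm0 expr0n addr0 enormN.
  have := ler_wpM2r (enorm_ge0 (p' - p)) (ltW p'e); lra.
- rewrite yA enormN (le_trans (enormD _ _)) // !enormZ ger0_norm //.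
  have := bP (p - pb); have := ler_wpM2l b0 (ltW pz'); lra.
- rewrite /y (le_trans (enormB _ _)) // enormZ ger0_norm //.
  have : enorm y0 <= c.
    rewrite enormZ ger0_norm; last by rewrite divr_ge0 // ltW.
    by rewrite mulrAC ler_pdivrMr // ler_wpM2l.
  by lra.
- by have := mulr_ge0 (ltW r_gt0) b0; lra.
Qed.

End multipliers.


(** * Multipliers from a global error bound, and their limits *)

Section multiplier_limits.
Context {R : realType} {n d : nat}.
Variables (A : 'M[R]_(n, d)) (h : 'rV[R]_d) (K : set 'rV[R]_d).

(** The estimate [dist(s, M) <= k dist(s A + h, K)] with both distances unfolded; the slack [e]
    spares the choice of nearest points. *)
Definition err_bound (k : R) : Prop := forall s p, K p -> forall e, 0 < e ->
  exists2 s', K (s' *m A + h) & enorm (s' - s) <= k * enorm (s *m A + h - p) + e.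

Let M := [set s : 'rV[R]_n | K (s *m A + h)].

Hypotheses (Kp : is_poly K) (Kc : is_cone K).

Lemma exact_penalty k x z : 0 <= k -> err_bound k -> regular_normal M z x ->
  exists2 r, 0 < r & forall s p, enorm (s - z) < r -> K p ->
    dot x (s - z) <= k * enorm x * enorm (s *m A + h - p).
Proof.
move=> k0 Ek Nx.
have [r r0 rP] := regular_normal_poly (is_poly_affine_preimage A h Kp) Nx.
exists (r / 2); first by rewrite divr_gt0.
move=> s p sr pK; set m := enorm (s *m A + h - p).
(* In the first case Cauchy-Schwarz suffices. In the second, [k m < r / 2], so a point of [M] near
   [s] lies in the ball around [z] where [x] is nonpositive on [M - z]. *)
have [km|km] := leP (enorm (s - z)) (k * m).
  apply: le_trans (dot_le _ _) _; rewrite [k * _]mulrC -mulrA.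
  by rewrite ler_wpM2l ?enorm_ge0.
rewrite -subr_le0; apply: (@le0_of_le_eps _ _ (enorm x)); first exact: enorm_ge0.
move=> e e0.
have [|s' Ms' ss'] := Ek s p pK (Num.min e (r / 2 - k * m)).
  by rewrite lt_min e0 subr_gt0 (lt_trans km).
have := ss'; rewrite -/m => ss1.
have e1 : Num.min e (r / 2 - k * m) <= e by rewrite ge_min lexx.
have e2 : Num.min e (r / 2 - k * m) <= r / 2 - k * m by rewrite ge_min lexx orbT.
have s'z : enorm (s' - z) < r by have := enorm_distD s s' z; lra.
have := rP s' s'z Ms'; have := dot_le x (s - s'); rewrite enormBC !dotBr.
have : enorm x * enorm (s' - s) <= enorm x * (k * m + e).
  by rewrite ler_wpM2l ?enorm_ge0 //; lra.
lra.
Qed.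

Lemma normal_multiplier k x z : 0 <= k -> err_bound k -> regular_normal M z x ->
  forall e, 0 < e -> exists y p, [/\ regular_normal K p y,
    enorm (y *m A^T - x) <= e, enorm y <= k * enorm x + e
    & `|dot y h + dot x z| <= e].
Proof.
move=> k0 Ek Nx e e0; have [Mz _] := Nx.
have c0 : 0 <= k * enorm x by rewrite mulr_ge0 ?enorm_ge0.
(* A tolerance [e' <= 1] gives [|y| <= k |x| + 1], so the errors [|y| e'] and [e' |z|] add up to at
   most [e' b]. *)
pose b := k * enorm x + 1 + enorm z.
have b1 : 1 <= b by have := enorm_ge0 z; rewrite /b; lra.
have b0 : 0 < b by lra.
have e'0 : 0 < Num.min 1 (e / b) by rewrite lt_min ltr01 divr_gt0.
have [y [p [Ny yA yk pz]]] :=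
  penalty_multiplier Kp c0 Mz (exact_penalty k0 Ek Nx) e'0.
set e' := Num.min 1 (e / b) in e'0 yA yk pz.
have e'1 : e' <= 1 by rewrite ge_min lexx.
have e'e : e' * b <= e by rewrite -ler_pdivlMr // ge_min lexx orbT.
have e'e' : e' <= e by nra.
exists y, p; split=> //; [exact: le_trans e'e'|lra|].
have -> : dot y h + dot x z = dot y (z *m A + h - p) - dot (y *m A^T - x) z.
  rewrite dotBr dotDr (regular_normal_cone_orth Kc Ny) dotBl.
  by rewrite (dotC (y *m _)) -dot_mulmx (dotC _ y); ring.
apply: le_trans (ler_normB _ _) _; apply: le_trans e'e.
have := dot_abs_le y (z *m A + h - p); rewrite enormBC.
have := dot_abs_le (y *m A^T - x) z.
have := ler_wpM2r (enorm_ge0 z) yA; have := ler_wpM2l (enorm_ge0 y) pz.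
have : enorm y * e' <= (k * enorm x + 1) * e' by rewrite ler_pM2r //; lra.
rewrite /b; lra.
Qed.

(** The multipliers stay in a ball and cluster there. The points [z] may be unbounded, since only
    the products [dot x' z] enter the limit. *)
Lemma multiplier_limit C v kappa x c :
  local_cone C v K -> C v -> 0 <= kappa ->
  (forall e, 0 < e -> exists2 k, 0 <= k <= kappa + e & err_bound k) ->
  (forall e, 0 < e -> exists x' z,
     [/\ regular_normal M z x', enorm (x' - x) <= e & `|dot x' z + c| <= e]) ->
  exists y, [/\ limiting_normal C v y, x = y *m A^T, enorm y <= kappa * enorm x
    & dot y h = c].
Proof.
move=> CK Cv kappa0 Ek Nx.
pose P e y := [/\ exists p, regular_normal K p y, enorm (y *m A^T - x) <= e,
  enorm y <= kappa * enorm x + e & `|dot y h - c| <= e].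
have x0 := enorm_ge0 x.
have [||y _ yP] := @approx_cluster R d (kappa * enorm x + 1) P.
- by move=> e e' y ee' [yp yA yk yh]; split=> //; lra.
- move=> e0 e00; pose e := Num.min e0 1.
  have e_gt0 : 0 < e by rewrite lt_min e00 /=.
  have ee0 : e <= e0 by rewrite ge_min lexx.
  have e1 : e <= 1 by rewrite ge_min lexx orbT.
  suff [y [yp yA yk yh]] : exists y, P e y.
    by exists y; [lra|split=> //; lra].
  (* Chosen so that [(kappa + f) (|x| + f) + f <= kappa |x| + f b] for [f <= 1]. *)
  pose b := enorm x + kappa + 2; have b0 : 2 <= b by rewrite /b; lra.
  pose f := e / b; have f0 : 0 < f by rewrite divr_gt0 //; lra.
  have fb : f * b = e by rewrite /f divfK // gt_eqF //; lra.
  have f1 : f + f <= e by nra.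
  have [k /andP[k0 kk] Hk] := Ek f f0.
  have [x' [z [Nx' xx' zc]]] := Nx f f0.
  have [y [p [Ny yA yk yh]]] := normal_multiplier k0 Hk Nx' f0.
  exists y; split.
  + by exists p.
  + have := enorm_distD x' (y *m A^T) x; lra.
  + have x'x : enorm x' <= enorm x + f by have := enorm_lerB x' x; lra.
    have : k * enorm x' <= (kappa + f) * (enorm x + f).
      by rewrite ler_pM // enorm_ge0.
    by move: fb; rewrite /b; nra.
  + have -> : dot y h - c = (dot y h + dot x' z) - (dot x' z + c) by ring.
    by apply: le_trans (ler_normB _ _) _; lra.
have [a a0 aP] := enorm_mulmx A^T.
exists y; split.
- apply: (limiting_normal_closure Kc CK Cv) => e e0.
  by have [y' yy' [yp _ _ _]] := yP e e0; exists y'.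
- apply/eqP; rewrite eq_sym -subr_eq0; apply/eqP/enorm_eq0/eqP.
  rewrite eq_le enorm_ge0 andbT; apply: (@le0_of_le_eps _ _ (a + 1)); first by lra.
  move=> e e0; have [y' yy' [_ yA _ _]] := yP e e0.
  have := enorm_distD (y' *m A^T) (y *m A^T) x; rewrite -mulmxBl.
  have := aP (y - y'); rewrite enormBC in yy'; have := ler_wpM2l a0 (ltW yy').
  lra.
- rewrite -subr_le0; apply: (@le0_of_le_eps _ _ 2); first by [].
  move=> e e0; have [y' yy' [_ _ yk _]] := yP e e0.
  by have := enorm_lerB y y'; rewrite enormBC; lra.
- apply/eqP; rewrite -subr_eq0 -normr_le0.
  have h0 := enorm_ge0 h; apply: (@le0_of_le_eps _ _ (enorm h + 1)); first by lra.
  move=> e e0; have [y' yy' [_ _ _ yh]] := yP e e0.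
  have -> : dot y h - c = (dot y' h - c) - dot (y' - y) h by rewrite dotBl; ring.
  apply: le_trans (ler_normB _ _) _.
  have := dot_abs_le (y' - y) h; have := ler_wpM2r h0 (ltW yy'); lra.
Qed.

End multiplier_limits.

(** * Approximating a finite supremum by regular normals *)

Section support_points.
Context {R : realType} {n : nat}.

(* Tikhonov regularisation: maximise [<x, s> - t |s|^2] over [M]; this replaces
   the attainment of the supremum of a linear function over a polyhedral set. *)
Lemma sup_approx_normal (M : set 'rV[R]_n) x sg : is_poly M ->
  (forall s, M s -> dot x s <= sg) ->
  (forall e, 0 < e -> exists2 s, M s & sg - e < dot x s) ->
  forall e, 0 < e -> exists x' z,
    [/\ regular_normal M z x', enorm (x' - x) <= e & `|dot x' z - sg| <= e].
Proof.
move=> Mp Mle Mge e e0.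
(* The perturbation satisfies [|2 t z|^2 <= 8 f], since [t <= 1] and [t |z|^2 <= 2 f]; the value
   changes by less than [6 f]. *)
pose f := Num.min (e ^+ 2 / 8) (e / 6).
have f0 : 0 < f by rewrite lt_min !divr_gt0 // exprn_gt0.
have fe2 : 8 * f <= e ^+ 2 by rewrite mulrC -ler_pdivlMr // ge_min lexx.
have fe : 6 * f <= e by rewrite mulrC -ler_pdivlMr // ge_min lexx orbT.
have [s0 Ms0 s0f] := Mge f f0.
have s01 : 0 < enorm s0 ^+ 2 + 1 by rewrite ltr_wpDl // sqr_ge0.
pose t := Num.min 1 (f / (enorm s0 ^+ 2 + 1)).
have t0 : 0 < t by rewrite lt_min ltr01 divr_gt0.
have t1 : t <= 1 by rewrite ge_min lexx.
have ts0 : t * enorm s0 ^+ 2 <= f.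
  have : t * (enorm s0 ^+ 2 + 1) <= f by rewrite -ler_pdivlMr // ge_min lexx orbT.
  lra.
(* Outside this ball the regularising term exceeds [2 f], so the maximiser over the ball is a
   maximiser over all of [M]. *)
pose B := Num.sqrt (2 * f / t).
have B0 : 0 <= B by exact: sqrtr_ge0.
have B2 : B ^+ 2 = 2 * f / t by rewrite sqr_sqrtr // divr_ge0 ?mulr_ge0 // ltW.
have inB s : (enorm s <= B) = (t * enorm s ^+ 2 <= 2 * f).
  have -> : (enorm s <= B) = (enorm s ^+ 2 <= B ^+ 2).
    by rewrite ler_pXn2r ?nnegrE ?enorm_ge0.
  by rewrite B2 ler_pdivlMr // mulrC.
pose g s := dot x s - t * enorm s ^+ 2.
have cg : continuous g.
  move=> s; apply: (@continuousB _ _ _ (dot x) (fun s => t * enorm s ^+ 2)).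
    exact: dot_continuous.
  apply: (@continuousM _ _ (cst t) (fun s => enorm s ^+ 2)); first exact: cst_continuous.
  apply: (@continuous_comp _ _ _ (@enorm R n) (fun x => x ^+ 2)).
    exact: enorm_continuous.
  exact: exprn_continuous.
have [||z /set_mem[Mz /=]] :=
  @compact_EVT_max _ R g _ _ (@compact_poly_ball R n M 0 B Mp).
- by exists s0; split=> //=; rewrite subr0 inB; lra.
- by apply: continuous_subspaceT => s; exact: cg.
rewrite subr0 => zB zmax.
have gs0 : sg - 2 * f < g z.
  apply: lt_le_trans (zmax s0 _); first by rewrite /g; lra.
  by apply/mem_set; split=> //=; rewrite subr0 inB; lra.
have {}zmax s : M s -> g s <= g z.
  move=> Ms; have [sB|sB] := boolP (enorm s <= B).
    by apply: zmax; apply/mem_set; split=> //=; rewrite subr0.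
  move: sB; rewrite inB -ltNge => sB; have := Mle s Ms; move: gs0; rewrite /g; lra.
rewrite inB in zB; have xz := Mle z Mz.
have x'x : x - (2 * t) *: z - x = (- (2 * t)) *: z by rewrite addrAC subrr sub0r scaleNr.
exists (x - (2 * t) *: z), z; split.
- split=> // a a0; apply/nbhs_enormP; exists a => // s sa Ms.
  (* Expanding [g s <= g z] around [z] leaves exactly this quadratic term. *)
  apply: (@le_trans _ _ (t * enorm (s - z) ^+ 2)).
    have := zmax s Ms; rewrite /g !sqr_enorm !(dotBl, dotBr, dotZl) (dotC z s); lra.
  have := enorm_ge0 (s - z); nra.
- rewrite x'x enormZ normrN gtr0_norm ?mulr_gt0 //.
  rewrite -(@ler_pXn2r _ 2) ?nnegrE ?mulr_ge0 ?enorm_ge0 ?(ltW e0) ?(ltW t0) //.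
  apply: le_trans fe2; rewrite !exprMn; have := sqr_ge0 (enorm z).
  have : t * (t * enorm z ^+ 2) <= 1 * (2 * f).
    have := mulr_ge0 (ltW t0) (sqr_ge0 (enorm z)); set w := t * enorm z ^+ 2 in zB *.
    nra.
  lra.
- rewrite dotBl dotZl -sqr_enorm; move: gs0; rewrite /g ler_norml => gs0.
  have := mulr_ge0 (ltW t0) (sqr_ge0 (enorm z)).
  by move=> ?; apply/andP; split; lra.
Qed.

End support_points.


(** * Directional neighbourhoods in terms of pairs [(t, w)] with [w] near [u] *)

Section directional_neighbourhoods.
Context {R : realType} {n : nat}.
Implicit Types u w x : 'rV[R]_n.

Lemma dir_nbhd_ball u delta rho : 0 < delta -> 0 < rho ->
  exists2 r, 0 < r & forall t w, 0 < t -> t < r -> enorm (w - u) < r ->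
    dir_nbhd delta rho u (t *: w).
Proof.
move=> delta0 rho0.
have a0 := enorm_ge0 u; set a := enorm u in a0 *.
(* The last condition is the angular one, solved by [r <= rho a / (2 + rho)]. For [u = 0] the
   angular inequality is [0 <= 0], and only the radius matters. *)
have [r [r0 r1 ra rr]] : exists r, [/\ 0 < r, r <= 1, r * (a + 1) <= delta &
    a = 0 \/ 2 * r <= rho * (a - r)].
  have [au|au] := eqVneq a 0.
    exists (Num.min 1 (delta / (a + 1))); split; last by left.
    - by rewrite lt_min ltr01 divr_gt0 // ltr_wpDl.
    - by rewrite ge_min lexx.
    - by rewrite -ler_pdivlMr ?ltr_wpDl // ge_min lexx orbT.
  have a_gt0 : 0 < a by rewrite lt_def au.
  exists (Num.min 1 (Num.min (delta / (a + 1)) (rho * a / (2 + rho)))); split.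
  - by rewrite !lt_min ltr01 !divr_gt0 ?mulr_gt0 ?ltr_wpDl // ltr_wpDl // ltW.
  - by rewrite ge_min lexx.
  - by rewrite -ler_pdivlMr ?ltr_wpDl // !ge_min lexx orbT.
  - right; set r := Num.min _ _.
    have : r <= rho * a / (2 + rho) by rewrite !ge_min lexx !orbT.
    by rewrite ler_pdivlMr; lra.
exists r => // t w t0 tr wr.
have wa : enorm w < a + r by have := enorm_lerB w u; rewrite -/a; lra.
have wa' : a - r < enorm w by have := enorm_lerB u w; rewrite enormBC -/a; lra.
split.
  rewrite enormZ gtr0_norm //; apply: lt_le_trans ra.
  by have := enorm_ge0 w; nra.
rewrite -/a; case: rr => [a00|rr].
  by move: (enorm_eq0 a00) => ->; rewrite a00 scale0r scaler0 subr0 enorm0 mulr0.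
have -> : a *: (t *: w) - enorm (t *: w) *: u =
  t *: (a *: (w - u) + (a - enorm w) *: u).
  rewrite enormZ gtr0_norm //.
  by apply/rowP => i; rewrite !mxE; ring.
rewrite !enormZ gtr0_norm // [rho * _]mulrCA -!mulrA ler_pM2l //.
apply: le_trans (enormD _ _) _; rewrite !enormZ ger0_norm // -/a.
have : `|a - enorm w| <= r by rewrite ler_norml; lra.
move/(ler_wpM2r a0); have := ler_wpM2l a0 (ltW wr).
have : a * (2 * r) <= a * (rho * enorm w).
  rewrite ler_wpM2l // (le_trans rr) // ler_wpM2l //; lra.
lra.
Qed.

(** The final bound turns estimates of order [t^2] into proximal ones. For [u = 0] the neighbourhood
    is a full ball, and [t] is chosen so that [|w| = r / 2]. *)
Lemma dir_nbhd_polar u r : 0 < r ->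
  exists delta rho c, [/\ 0 < delta, 0 < rho, 0 < c &
    forall x, dir_nbhd delta rho u x -> x != 0 ->
      exists t w, [/\ 0 < t < r, enorm (w - u) < r, x = t *: w &
        t ^+ 2 <= c * enorm x ^+ 2]].
Proof.
move=> r0.
have x_gt0 x : x != 0 -> 0 < enorm x.
  by move=> x0; rewrite lt_def enorm_ge0 andbT; apply: contraNneq x0 => /enorm_eq0 ->.
have [->|u0] := eqVneq u 0.
  exists (r ^+ 2 / 2), 1, (4 / r ^+ 2).
  rewrite ltr01 !divr_gt0 ?exprn_gt0 //; split=> // x [xr _] x0.
  have xp := x_gt0 x x0; exists (2 * enorm x / r), ((r / 2 / enorm x) *: x); split.
  - by rewrite divr_gt0 ?mulr_gt0 // ltr_pdivrMr // -expr2; lra.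
  - rewrite subr0 enormZ ger0_norm ?divr_ge0 ?(ltW xp) ?(ltW r0) //.
    by rewrite divfK ?gt_eqF //; lra.
  - rewrite scalerA (_ : _ * _ = 1) ?scale1r //.
    by field; rewrite !gt_eqF.
  - by rewrite (_ : _ ^+ 2 = 4 / r ^+ 2 * enorm x ^+ 2) //; field; rewrite gt_eqF.
have up := x_gt0 u u0.
exists (r * enorm u), (r / (2 * enorm u)), ((enorm u ^+ 2)^-1).
rewrite invr_gt0 !(divr_gt0, mulr_gt0, exprn_gt0) //; split=> // x [xr xu] x0.
have xp := x_gt0 x x0; exists (enorm x / enorm u), ((enorm u / enorm x) *: x); split.
- by rewrite divr_gt0 // ltr_pdivrMr.
- have -> : (enorm u / enorm x) *: x - u =
    (enorm x)^-1 *: (enorm u *: x - enorm x *: u).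
    by rewrite scalerBr !scalerA mulVf ?gt_eqF // scale1r mulrC.
  rewrite enormZ ger0_norm ?invr_ge0 ?(ltW xp) // mulrC ltr_pdivrMr //.
  apply: le_lt_trans xu _.
  rewrite (_ : _ * _ * _ = r * enorm x / 2); last by field; rewrite gt_eqF.
  by have := mulr_gt0 r0 xp; lra.
- rewrite scalerA (_ : _ * _ = 1) ?scale1r //.
  by field; rewrite !gt_eqF.
- by rewrite exprMn exprVn mulrC.
Qed.

End directional_neighbourhoods.

(** * Second-order analysis of the feasible set in direction [u] *)

Section constraint_system.
Context {R : realType} {n d : nat}.
Variables (G : 'rV[R]_n -> 'rV[R]_d) (D : set 'rV[R]_d) (xbar u : 'rV[R]_n).
Variables (C K : set 'rV[R]_d).

Let A := 'J G xbar.
Let yb := G xbar.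
Let v := u *m A.
Let h := hess_quad G xbar u.
Let Gamma := feasible G D.

Hypothesis (hG : twice_cont_diff G).
Hypotheses (Cp : is_poly C) (Cc : is_cone C) (DC : local_cone D yb C).
Hypotheses (Kp : is_poly K) (Kc : is_cone K) (CK : local_cone C v K).
Hypothesis (Cv : C v).

Lemma is_coneZ m (L : set 'rV[R]_m) t w : is_cone L -> 0 < t -> L (t *: w) <-> L w.
Proof.
move=> Lc t0; split; last exact: Lc.
have ti : 0 < t^-1 by rewrite invr_gt0.
by move=> /(Lc _ _ ti); rewrite scalerA mulVf ?gt_eqF // scale1r.
Qed.

(** Division by [t] leaves [v + (t / 2) p] in [C], and then the factor [t / 2] drops out of
    membership in [K]. Only [t p] must be small; [p] itself may be unbounded. *)
Lemma second_order_cone : exists2 r, 0 < r & forall t p, 0 < t -> t < r ->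
  enorm (t *: p) < r -> D (yb + t *: v + (2^-1 * t ^+ 2) *: p) <-> K p.
Proof.
have [r1 r10 r1P] := DC; have [r2 r20 r2P] := CK.
have v0 := enorm_ge0 v.
have v2 : 0 < enorm v + 1 + 1 by rewrite ltr_wpDl // addr_ge0.
exists (Num.min (Num.min 1 r2) (r1 / (enorm v + 1 + 1))).
  by rewrite !lt_min ltr01 r20 divr_gt0.
move=> t p t0; rewrite !lt_min => /andP[/andP[t1 tr2] tr1] /andP[/andP[p1 pr2] pr1].
rewrite (_ : yb + _ + _ = yb + t *: (v + 2^-1 *: (t *: p))); last first.
  by rewrite scalerDr !scalerA addrA; congr (_ + _ *: _); ring.
have th : enorm (2^-1 *: (t *: p)) = 2^-1 * enorm (t *: p).
  by rewrite enormZ ger0_norm.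
have p0 := enorm_ge0 (t *: p).
rewrite (_ : D _ <-> _); last first.
  apply: r1P; rewrite enormZ gtr0_norm //; move: tr1; rewrite ltr_pdivlMr //.
  apply: le_lt_trans; rewrite ler_pM2l // (le_trans (enormD _ _)) // th; lra.
rewrite (is_coneZ _ Cc t0) r2P; last by rewrite th; lra.
by rewrite (is_coneZ _ Kc) // is_coneZ.
Qed.

Lemma second_order_expansion e : 0 < e -> exists2 r, 0 < r & forall t s, 0 < t -> t < r ->
  enorm (t *: s) < r ->
  enorm (G (xbar + t *: u + (2^-1 * t ^+ 2) *: s) -
    (yb + t *: v + (2^-1 * t ^+ 2) *: (s *m A + h))) <= e * t ^+ 2.
Proof.
move=> e0; have [r r0 rP] := taylor2_dir xbar u hG e0; exists r => // t s t0 tr sr.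
have := rP t (u + 2^-1 *: (t *: s)) t0 tr.
have -> : u + 2^-1 *: (t *: s) - u = 2^-1 *: (t *: s) by rewrite addrC addKr.
rewrite enormZ ger0_norm //.
have -> : 2^-1 * enorm (t *: s) < r by have := enorm_ge0 (t *: s); lra.
move=> /(_ isT).
have -> : xbar + t *: (u + 2^-1 *: (t *: s)) = xbar + t *: u + (2^-1 * t ^+ 2) *: s.
  by rewrite scalerDr !scalerA addrA; congr (_ + _ *: _); ring.
congr (enorm _ <= _).
rewrite -/A -/yb mulmxDl -!scalemxAl -/v -/h; set sA := s *m A.
by apply/rowP => i; rewrite !mxE; ring.
Qed.

(** The witness is the rescaled second-order part of [G x] itself: it lies in [K] exactly, and the
    expansion puts it within [e] of [s A + h]. *)
Lemma feasible_approx e : 0 < e -> exists2 r, 0 < r & forall t s, 0 < t -> t < r ->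
  enorm (t *: s) < r -> Gamma (xbar + t *: u + (2^-1 * t ^+ 2) *: s) ->
  exists2 p, K p & enorm (s *m A + h - p) <= e.
Proof.
move=> e0; have [r1 r10 r1P] := second_order_cone.
have e20 : 0 < e / 2 by rewrite divr_gt0.
have [r2 r20 r2P] := second_order_expansion e20.
have [a a0 aP] := enorm_mulmx A.
have h0 := enorm_ge0 h.
(* With [t] and [|t s|] below [r1 / b], the identity [t p = (t s) A + t h - t (s A + h - p)] gives
   [|t p| < r1]. *)
pose b := a + enorm h + e + 1.
have b0 : 0 < b by rewrite /b; lra.
exists (Num.min (Num.min r1 r2) (r1 / b)); first by rewrite !lt_min r10 r20 divr_gt0.
move=> t s t0; rewrite !lt_min => /andP[/andP[tr1 tr2] trb] /andP[/andP[sr1 sr2] srb].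
set x := xbar + _ + _ => Gx.
have {r2P} := r2P t s t0 tr2 sr2; rewrite -/x => E.
have t20 : 0 < t ^+ 2 by rewrite exprn_gt0.
pose p := (2 / t ^+ 2) *: (G x - (yb + t *: v)).
have tp : (2^-1 * t ^+ 2) *: p = G x - (yb + t *: v).
  by rewrite /p scalerA (_ : _ * _ = 1) ?scale1r //; field; rewrite gt_eqF.
have pe : enorm (s *m A + h - p) <= e.
  rewrite enormBC -(@ler_pM2l _ (2^-1 * t ^+ 2)) ?mulr_gt0 //.
  rewrite -[leLHS](_ : enorm ((2^-1 * t ^+ 2) *: (p - (s *m A + h))) = _); last first.
    by rewrite enormZ gtr0_norm // mulr_gt0.
  rewrite scalerBr tp -addrA -opprD; apply: le_trans E _; lra.
exists p => //; apply/(r1P t); rewrite ?tp ?subrKC //.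
move: trb srb; rewrite !ltr_pdivlMr // => trb srb.
have -> : t *: p = (t *: s) *m A + t *: h - t *: (s *m A + h - p).
  rewrite -scalemxAl; set sA := s *m A.
  by apply/rowP => i; rewrite !mxE; ring.
apply: le_lt_trans (enormB _ _) _; rewrite enormZ gtr0_norm //.
have := enormD ((t *: s) *m A) (t *: h); rewrite enormZ gtr0_norm //.
have := aP (t *: s); have := ler_wpM2l (ltW t0) pe.
have : enorm (t *: s) < r1 / b by rewrite ltr_pdivlMr.
have : t < r1 / b by rewrite ltr_pdivlMr.
set m := r1 / b => tm sm.
have mb : m * b = r1 by rewrite /m divfK // gt_eqF.
have m0 : 0 < m by rewrite divr_gt0.
have := ler_wpM2l a0 (ltW sm); have := ler_wpM2r h0 (ltW tm).
have := ler_wpM2r (ltW e0) (ltW tm); move: mb; rewrite /b; lra.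
Qed.

Lemma mscq_const_ball k : mscq_const G D xbar u k ->
  exists2 r, 0 < r & forall t w, 0 < t -> t < r -> enorm (w - u) < r ->
    forall q, D q -> forall e, 0 < e -> exists2 x', Gamma x' &
      enorm (x' - (xbar + t *: w)) <= k * enorm (G (xbar + t *: w) - q) + e.
Proof.
move=> [k0 [delta [rho [delta0 rho0 H]]]].
have [r r0 rP] := dir_nbhd_ball u delta0 rho0; exists r => // t w t0 tr wr q Dq e e0.
have /H : dir_nbhd delta rho u (xbar + t *: w - xbar) by rewrite addrC addKr; exact: rP.
set x := xbar + t *: w => Hx.
have : (dist x (feasible G D) < (k * enorm (G x - q) + e)%:E)%E.
  apply: le_lt_trans Hx _; apply: (@le_lt_trans _ _ (k * enorm (G x - q))%:E).
    rewrite EFinM lee_wpmul2l ?lee_fin ?(ltW k0) //.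
    by apply: ereal_inf_lbound; exists q.
  by rewrite lte_fin ltrDl.
move=> /ereal_inf_lt[_ [x' Gx' <-]]; rewrite lte_fin => /ltW.
by exists x' => //; rewrite enormBC.
Qed.

(** MSCQ compares the second-order curve of [s] with the point of [D] on the curve of [p]. Both
    sides scale by [t^2 / 2], so the constant [k] survives. *)
Lemma feasible_near k s p : mscq_const G D xbar u k -> K p -> forall e, 0 < e ->
  exists2 r, 0 < r & forall t, 0 < t -> t < r -> exists2 s',
    enorm (s' - s) <= k * enorm (s *m A + h - p) + e &
    Gamma (xbar + t *: u + (2^-1 * t ^+ 2) *: s').
Proof.
move=> Hk Kpp e e0; have [k0 _] := Hk.
have [r1 r10 r1P] := mscq_const_ball Hk.
have [r2 r20 r2P] := second_order_cone.
have k1 : 0 < 4 * (k + 1) by lra.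
(* After multiplication by [2 / t^2] the expansion error, weighted by [k], and the slack of MSCQ
   cost at most [e / 2] each. *)
have e'0 : 0 < e / (4 * (k + 1)) by rewrite divr_gt0.
have [r3 r30 r3P] := second_order_expansion e'0.
pose r := Num.min r1 (Num.min r2 r3).
have r_gt0 : 0 < r by rewrite !lt_min r10 r20.
have [t1 t10 t1P] := scale_small s r_gt0.
have [t2 t20 t2P] := scale_small p r_gt0.
exists (Num.min r (Num.min t1 t2)); first by rewrite lt_min r_gt0 lt_min t10.
move=> t t0; rewrite lt_min => /andP[tr]; rewrite lt_min => /andP[/ltW tt1 /ltW tt2].
have ts : enorm (t *: s) < r by apply: t1P; rewrite gtr0_norm.
have tp : enorm (t *: p) < r by apply: t2P; rewrite gtr0_norm.
move: tr ts tp; rewrite !lt_min => /and3P[tr1 tr2 tr3] /and3P[sr1 sr2 sr3] /and3P[pr1 pr2 pr3].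
have t20' : 0 < t ^+ 2 by rewrite exprn_gt0.
have [||x' Gx'] := r1P t (u + 2^-1 *: (t *: s)) t0 tr1 _ _
  ((r2P t p t0 tr2 pr2).2 Kpp) (t ^+ 2 * (e / 4)).
- rewrite addrC addKr enormZ ger0_norm //; have := enorm_ge0 (t *: s); lra.
- by rewrite mulr_gt0 // divr_gt0.
have -> : xbar + t *: (u + 2^-1 *: (t *: s)) = xbar + t *: u + (2^-1 * t ^+ 2) *: s.
  by rewrite scalerDr !scalerA addrA; congr (_ + _ *: _); ring.
have := r3P t s t0 tr3 sr3; set x := xbar + t *: u + _ *: s => E xx'.
exists (s + (2 / t ^+ 2) *: (x' - x)); last first.
  rewrite scalerDr scalerA (_ : _ * (2 / _) = 1); last by field; rewrite gt_eqF.
  by rewrite scale1r addrA -/x subrKC.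
rewrite addrC addKr enormZ gtr0_norm ?divr_gt0 // mulrC mulrA ler_pdivrMr //.
have Gq : enorm (G x - (yb + t *: v + (2^-1 * t ^+ 2) *: p)) <=
  e / (4 * (k + 1)) * t ^+ 2 + 2^-1 * t ^+ 2 * enorm (s *m A + h - p).
  apply: le_trans (enorm_distD (yb + t *: v + (2^-1 * t ^+ 2) *: (s *m A + h)) _ _) _.
  rewrite lerD // opprD addrACA subrr add0r -scalerBr enormZ gtr0_norm //.
  by rewrite mulr_gt0.
have := ler_wpM2l (ltW k0) Gq.
have : k * (e / (4 * (k + 1))) <= e / 4.
  rewrite mulrA ler_pdivrMr //; have := mulr_gt0 k0 e0; nra.
move/(ler_wpM2r (ltW t20')); lra.
Qed.

(** Here [s] and [p] are fixed while [t] tends to [0], so the bound is global although MSCQ is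
    local. The corrected points depend on [t] but stay in one ball, where they cluster. *)
Lemma mscq_err_bound k : mscq_const G D xbar u k -> err_bound A h K k.
Proof.
move=> Hk s p Kpp e e0; have [k0 _] := Hk.
set m := k * enorm (s *m A + h - p).
have e20 : 0 < e / 2 by rewrite divr_gt0.
have [r r0 rP] := feasible_near s Hk Kpp e20; rewrite -/m in rP.
pose P e' s' := enorm (s' - s) <= m + e / 2 /\
  exists2 p, K p & enorm (s' *m A + h - p) <= e'.
have [a a0 aP] := enorm_mulmx A.
pose B := m + e / 2 + enorm s.
have [||s' _ s'P] := @approx_cluster R n B P.
- by move=> e1 e2 s' e12 [s's [q Kq qe]]; split=> //; exists q => //; lra.
- move=> e' e'0; have [r' r'0 r'P] := feasible_approx e'0.
  have B0 : 0 < B + 1 + 1.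
    have m0 : 0 <= m by rewrite mulr_ge0 ?enorm_ge0 // ltW.
    by rewrite /B; have := enorm_ge0 s; lra.
  have r'B : 0 < Num.min r' (r' / (B + 1 + 1)) by rewrite lt_min r'0 divr_gt0.
  have [t [t0 tr]] := lt_both r0 r'B; rewrite lt_min ltr_pdivlMr // => /andP[tr' tB].
  have [s' s's Gs'] := rP t t0 tr.
  have s'B : enorm s' <= B by have := enorm_lerB s' s; rewrite /B; lra.
  exists s' => //; split=> //; apply: (r'P t) => //.
  rewrite enormZ gtr0_norm //; have := ler_wpM2l (ltW t0) s'B; lra.
exists s'.
  apply: (is_poly_closed Kp) => e1 e10.
  have [|s'' s's'' [_ [q Kq qe]]] := s'P (e1 / (a + 1 + 1)).
    by rewrite divr_gt0 //; lra.
  exists q => //; rewrite enormBC.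
  have -> : s' *m A + h - q = (s'' *m A + h - q) - (s'' - s') *m A.
    rewrite mulmxBl; set a1 := s' *m A; set a2 := s'' *m A.
    by apply/rowP => i; rewrite !mxE; ring.
  apply: le_lt_trans (enormB _ _) _.
  have := aP (s'' - s'); have := ler_wpM2l a0 (ltW s's'').
  have : e1 / (a + 1 + 1) * (a + 1 + 1) = e1 by rewrite divfK // gt_eqF //; lra.
  have : 0 < e1 / (a + 1 + 1) by rewrite divr_gt0 //; lra.
  lra.
have [s'' s's'' [s''s _]] := s'P _ e20.
have := enorm_distD s'' s' s; rewrite (enormBC s' s''); lra.
Qed.

(** MSCQ gives the inclusion of the right side: for [s] in [M] the residual in [feasible_near] is
    zero. *)
Lemma tangent_set2E k : mscq_const G D xbar u k ->
  tangent_set2 Gamma xbar u = [set s | K (s *m A + h)].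
Proof.
move=> Hk; have [a a0 aP] := enorm_mulmx A.
apply/seteqP; split=> s /=.
  move=> [t [w [t0 /cvg0_seqP tc /cvg_enormP wc Gw]]].
  apply: (is_poly_closed Kp) => e e0.
  have ea0 : 0 < e / (a + 1 + 1) by rewrite divr_gt0 //; lra.
  have [r r0 rP] := feasible_approx ea0.
  have [N1 N1P] := wc _ ea0; have [N2 N2P] := wc _ ltr01.
  have [N3 N3P] := tc _ r0.
  have s1 := enorm1_gt0 s.
  have [|N4 N4P] := tc (r / (enorm s + 1)); first by rewrite divr_gt0.
  pose N := maxn (maxn N1 N2) (maxn N3 N4).
  have {}N1P := N1P N; have {}N2P := N2P N; have {}N3P := N3P N; have {}N4P := N4P N.
  move: N1P N2P N3P N4P; rewrite !leq_max !leqnn !orbT => /(_ isT) W1 /(_ isT) W2 /(_ isT).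
  rewrite gtr0_norm // => T1 /(_ isT); rewrite ltr_pdivlMr // => T2.
  have wN : enorm (w N) < enorm s + 1 by have := enorm_lerB (w N) s; lra.
  have tN := t0 N.
  have [|p Kpp pe] := rP _ (w N) tN T1 _ (Gw N).
    by rewrite enormZ gtr0_norm //; nra.
  exists p => //; rewrite enormBC.
  have -> : s *m A + h - p = (w N *m A + h - p) - (w N - s) *m A.
    rewrite mulmxBl; set a1 := s *m A; set a2 := w N *m A.
    by apply/rowP => i; rewrite !mxE; ring.
  apply: le_lt_trans (enormB _ _) _.
  have := aP (w N - s); have := ler_wpM2l a0 (ltW W1).
  have : e / (a + 1 + 1) * (a + 1 + 1) = e by rewrite divfK // gt_eqF //; lra.
  lra.
move=> Ks.
have /choice[f fP] : forall k : nat, exists ts : R * 'rV[R]_n,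
    [/\ 0 < ts.1, ts.1 <= k.+1%:R^-1, enorm (ts.2 - s) <= k.+1%:R^-1 &
      Gamma (xbar + ts.1 *: u + (2^-1 * ts.1 ^+ 2) *: ts.2)].
  move=> i; have i0 : 0 < (i.+1%:R^-1 : R) by rewrite invr_gt0.
  have [r r0 rP] := feasible_near s Hk Ks i0.
  have [t [t0 tr /ltW ti]] := lt_both r0 i0.
  have [s' s's Gs'] := rP t t0 tr; exists (t, s'); split=> //=.
  by move: s's; rewrite subrr enorm0 mulr0 add0r.
exists (fun k => (f k).1), (fun k => (f k).2); split.
- by move=> i; have [] := fP i.
- apply/cvg0_seqP => e /invS_small[N NP]; exists N => i /NP; apply: le_lt_trans.
  by have [i0 ? _ _] := fP i; rewrite gtr0_norm.
- apply/cvg_enormP => e /invS_small[N NP]; exists N => i /NP; apply: le_lt_trans.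
  by have [] := fP i.
- by move=> i; have [] := fP i.
Qed.

(* Apply the error bound for [M] to large multiples of [s] and [p] and rescale. *)
Lemma recession_near k s p : 0 <= k -> err_bound A h K k -> K p ->
  exists2 s', K (s' *m A) &
    enorm (s' - s) <= k * enorm (s *m A - p) + (k * enorm h + 1).
Proof.
move=> k0 Ek Kpp; set B1 := _ + _.
pose P e s' := enorm (s' - s) <= B1 /\
  exists2 e', 0 < e' <= e & K (s' *m A + e' *: h).
have [||s' _ s'P] := @approx_cluster R n (B1 + enorm s) P.
- move=> e1 e2 s' e12 [s's [e' /andP[e'0 e'1] Ke']]; split=> //.
  by exists e' => //; rewrite e'0 (le_trans e'1).
- move=> e e0; pose e' := Num.min e 1.
  have e'0 : 0 < e' by rewrite lt_min e0 /=.
  have e'1 : e' <= 1 by rewrite ge_min lexx orbT.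
  have ei0 : 0 < e'^-1 by rewrite invr_gt0.
  have [m Km] := Ek (e'^-1 *: s) (e'^-1 *: p) (Kc ei0 Kpp) 1 ltr01.
  have -> : (e'^-1 *: s) *m A + h - e'^-1 *: p = e'^-1 *: (s *m A - p) + h.
    by rewrite -scalemxAl scalerBr addrAC.
  move=> mP; have ms : enorm (e' *: m - s) <= B1.
    have -> : e' *: m - s = e' *: (m - e'^-1 *: s).
      by rewrite scalerBr scalerA mulfV ?scale1r // gt_eqF.
    rewrite enormZ gtr0_norm //; apply: le_trans (ler_wpM2l (ltW e'0) mP) _.
    have := enormD (e'^-1 *: (s *m A - p)) h; rewrite enormZ gtr0_norm //.
    move=> /(ler_wpM2l k0)/(ler_wpM2l (ltW e'0)) H.
    have E : e' * (k * (e'^-1 * enorm (s *m A - p) + enorm h)) =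
      k * enorm (s *m A - p) + e' * (k * enorm h) by field; rewrite gt_eqF.
    rewrite E in H.
    have : e' * (k * enorm h + 1) <= 1 * (k * enorm h + 1).
      by rewrite ler_pM2r // ltr_wpDl // mulr_ge0 // enorm_ge0.
    by rewrite /B1; lra.
  exists (e' *: m); first by have := enorm_lerB (e' *: m) s; lra.
  split=> //; exists e'; first by rewrite e'0 ge_min lexx.
  by rewrite -scalemxAl -scalerDr; exact: Kc.
have [a a0 aP] := enorm_mulmx A.
have h0 := enorm_ge0 h.
exists s'.
  apply: (is_poly_closed Kp) => e1 e10.
  have b0 : 0 < a + enorm h + 1 by lra.
  have [|s'' s's'' [_ [e' /andP[e'0 e'1] Ke']]] := s'P (e1 / (a + enorm h + 1)).
    by rewrite divr_gt0.
  exists (s'' *m A + e' *: h) => //.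
  rewrite addrAC -mulmxBl; apply: le_lt_trans (enormD _ _) _.
  rewrite enormZ gtr0_norm //.
  have := aP (s'' - s'); have := ler_wpM2l a0 (ltW s's'').
  have := ler_wpM2r h0 e'1.
  have : e1 / (a + enorm h + 1) * (a + enorm h + 1) = e1 by rewrite divfK // gt_eqF.
  have : 0 < e1 / (a + enorm h + 1) by rewrite divr_gt0.
  lra.
rewrite -subr_le0; apply: (@le0_of_le_eps _ _ 1) => // e e0.
have [s'' s's'' [s''s _]] := s'P e e0.
have := enorm_distD s'' s' s; rewrite (enormBC s' s''); lra.
Qed.

Let M := [set s : 'rV[R]_n | K (s *m A + h)].
(** The homogeneous counterpart of [M]; it plays the role of a recession cone. *)
Let M0 := [set w : 'rV[R]_n | K (w *m A)].

Let K0 : K 0.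
Proof. exact/(local_coneT CK). Qed.

(** A point of [M0] has residual [h] with respect to [M], so it lies within about [k |h|] of [M];
    [recession_near] gives the converse. A linear form therefore has the same growth on both sets,
    and on a cone boundedness above means nonpositivity. *)
Lemma bounded_above_polar k x : 0 <= k -> err_bound A h K k ->
  (exists B, forall s, M s -> dot x s <= B) <-> (forall w, M0 w -> dot x w <= 0).
Proof.
move=> k0 Ek; split.
  move=> [B BP] w Kw; pose b := `|B| + enorm x * (k * enorm h + 1) + 1.
  have k1 : 0 < k * enorm h + 1 by rewrite ltr_wpDl // mulr_ge0 // enorm_ge0.
  have b0 : 0 <= b.
    by have := normr_ge0 B; have := mulr_ge0 (enorm_ge0 x) (ltW k1); rewrite /b; lra.
  apply: (le0_of_le_eps b0) => e e0.
  have ei0 : 0 < e^-1 by rewrite invr_gt0.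
  have [s' Ms'] := Ek (e^-1 *: w) (e^-1 *: (w *m A)) (Kc ei0 Kw) 1 ltr01.
  rewrite -scalemxAl addrAC subrr add0r => s'w.
  have := BP s' Ms'; have := dot_abs_le x (s' - e^-1 *: w).
  rewrite ler_norml dotBr dotZr => /andP[+ _].
  have := ler_wpM2l (enorm_ge0 x) s'w; have := ler_norm B.
  move=> H1 H2 H3 H4; rewrite mulrC -ler_pdivrMr // mulrC /b; lra.
move=> H; exists (enorm x * (k * enorm h + (k * enorm h + 1))) => s Ms.
have [s' Ks'] := recession_near s k0 Ek Ms.
rewrite (_ : s *m A - _ = - h) ?enormN => [s's|]; last first.
  by rewrite opprD addrA subrr sub0r.
have := H s' Ks'; have := dot_le x (s - s'); rewrite enormBC dotBr.
have := ler_wpM2l (enorm_ge0 x) s's; lra.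
Qed.

(** Small multiples of both [u] and [- u] lie in [M0], because [v + a v] is a positive multiple of
    [v], hence in [C]. *)
Lemma polar_orth x : (forall w, M0 w -> dot x w <= 0) -> dot u x = 0.
Proof.
move=> H; apply/eqP; rewrite dotC eq_le.
have [r r0 rP] := CK; have [t t0 tP] := scale_small v r0.
pose t' := Num.min t 2^-1; have t'0 : 0 < t' by rewrite lt_min t0 /=.
have t'h : t' <= 2^-1 by rewrite ge_min lexx orbT.
have t't : t' <= t by rewrite ge_min lexx.
have Kv a : `|a| = t' -> K (a *: v).
  move=> at'; apply/rP; first by apply: tP; rewrite at'.
  rewrite -[X in C (X + _)]scale1r -scalerDl; apply: Cc => //.
  have : `|a| < 1 by rewrite at'; lra.
  by rewrite ltr_norml; lra.
have M0u a : `|a| = t' -> a * dot x u <= 0.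
  by move=> at'; rewrite -dotZr; apply: H; rewrite /M0 /= -scalemxAl; exact: Kv.
have := M0u t' (gtr0_norm t'0); rewrite pmulr_rle0 // => ->.
have := M0u (- t'); rewrite normrN gtr0_norm // => /(_ erefl).
by rewrite mulNr oppr_le0 pmulr_rge0.
Qed.

Lemma feasible_slope k x sg : 0 <= k -> err_bound A h K k -> dot u x = 0 ->
  (forall s, M s -> dot x s <= sg) ->
  forall e, 0 < e -> exists2 r, 0 < r & forall t w, 0 < t -> t < r ->
    enorm (w - u) < r -> Gamma (xbar + t *: w) -> 2 * dot x w <= t * (sg + e).
Proof.
move=> k0 Ek ux xsg e e0.
pose b := enorm x * (k + 1) + 1.
have b0 : 0 < b by rewrite ltr_wpDl // mulr_ge0 ?enorm_ge0 // addr_ge0.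
have eb0 : 0 < e / b by rewrite divr_gt0.
have [r r0 rP] := feasible_approx eb0.
exists (r / 2); first by rewrite divr_gt0.
move=> t w t0 tr wr Gw.
(* Nothing bounds [s] as [t] tends to [0]; only [t s = 2 (w - u)] is small. *)
pose s := (2 / t) *: (w - u).
have ts : t *: s = 2 *: (w - u).
  by rewrite /s scalerA (_ : _ * _ = 2) //; field; rewrite gt_eqF.
have ws : w = u + 2^-1 *: (t *: s).
  by rewrite ts scalerA mulVf // scale1r subrKC.
have xw : xbar + t *: w = xbar + t *: u + (2^-1 * t ^+ 2) *: s.
  by rewrite [in LHS]ws scalerDr !scalerA addrA; congr (_ + _ *: _); ring.
have [|||p Kpp pe] := rP t s t0.
- by lra.
- by rewrite ts enormZ ger0_norm //; lra.
- by rewrite -xw.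
have [s' Ms' s's] := Ek s p Kpp _ eb0.
have -> : dot x w = t / 2 * dot x s.
  by rewrite ws dotDr (dotC x u) ux add0r dotZr (dotZr t); field.
have xs : dot x s <= sg + e.
  have := xsg s' Ms'; have := dot_le x (s - s'); rewrite dotBr enormBC.
  have := ler_wpM2l (enorm_ge0 x) s's.
  have := ler_wpM2l (enorm_ge0 x) (ler_wpM2l k0 pe).
  have : e / b * b = e by rewrite divfK // gt_eqF.
  move: eb0; set f := e / b; rewrite /b; lra.
have := ler_wpM2l (ltW t0) xs; lra.
Qed.

(** The recovery half of the liminf: [w = u + (t / 2) s'] with [s'] close to [s]. *)
Lemma feasible_curve k s x : mscq_const G D xbar u k -> M s -> forall e, 0 < e ->
  exists2 r, 0 < r & forall t, 0 < t -> t < r -> exists w,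
    [/\ enorm (w - u) < e, Gamma (xbar + t *: w) &
      `|2 * dot x (w - u) - t * dot x s| <= t * e].
Proof.
move=> Hk Ms e e0.
have x1 := enorm1_gt0 x; have s1 := enorm_ge0 s.
have f0 : 0 < e / (enorm x + 1) by rewrite divr_gt0.
have [r r0 rP] := feasible_near s Hk Ms f0; rewrite subrr enorm0 mulr0 add0r in rP.
set f := e / (enorm x + 1) in f0 rP.
have b0 : 0 < enorm s + f + 1 by lra.
exists (Num.min r (e / (enorm s + f + 1))); first by rewrite lt_min r0 divr_gt0.
move=> t t0; rewrite lt_min => /andP[tr te].
have [s' s's Gs'] := rP t t0 tr; exists (u + (t / 2) *: s').
have wu : u + (t / 2) *: s' - u = (t / 2) *: s' by rewrite addrC addKr.
rewrite wu; split.
- move: te; rewrite ltr_pdivlMr // enormZ gtr0_norm ?divr_gt0 //.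
  have : enorm s' <= enorm s + f by have := enorm_lerB s' s; lra.
  move/(ler_wpM2l (ltW t0)); have := mulr_ge0 (ltW t0) (enorm_ge0 s'); lra.
- move: Gs'; congr (Gamma _).
  by rewrite scalerDr scalerA addrA; congr (_ + _ *: _); field.
- rewrite (_ : _ - _ = t * dot x (s' - s)); last by rewrite dotZr dotBr; field.
  rewrite normrM gtr0_norm // ler_pM2l //; apply: le_trans (dot_abs_le _ _) _.
  have : f * (enorm x + 1) = e by rewrite /f divfK // gt_eqF.
  have := ler_wpM2l (enorm_ge0 x) s's; lra.
Qed.

(** MSCQ in direction [u] covers all directions near [u], so there the tangent cone is
    [{w | w A in C}]; translation by [u] turns [C] into [K]. *)
Lemma tangent_cone_feasible k : mscq_const G D xbar u k ->
  local_cone (tangent_cone Gamma xbar) u M0.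
Proof.
move=> Hk; have [k0 _] := Hk.
have [r1 r10 r1P] := CK; have [r2 r20 r2P] := DC.
have [r3 r30 r3P] := mscq_const_ball Hk.
have [r4 r40 r4P] := taylor2_dir xbar u hG ltr01.
have [a a0 aP] := enorm_mulmx A.
have h0 := enorm_ge0 h.
(* The quadratic term [t^2 |h| / 2] and the remainder [t^2] give the first-order error [c t^2]. *)
pose c := enorm h + 1.
have {}r4P t w : 0 < t -> t < r4 -> enorm (w - u) < r4 ->
    enorm (G (xbar + t *: w) - (yb + t *: (w *m A))) <= c * t ^+ 2.
  move=> t0 tr wr; have := r4P t w t0 tr wr; rewrite -/A -/yb -/h.
  set q := G _ - _ - _ - _ => qt.
  rewrite (_ : _ - _ = q + (2^-1 * t ^+ 2) *: h); last by rewrite /q subrK opprD addrA.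
  apply: le_trans (enormD _ _) _; rewrite enormZ gtr0_norm ?mulr_gt0 ?exprn_gt0 //.
  have := mulr_ge0 (sqr_ge0 t) h0; rewrite /c; lra.
exists (Num.min (r1 / (a + 1)) (Num.min (r3 / 2) (r4 / 2))).
  by rewrite !lt_min !divr_gt0 // ltr_wpDl.
move=> w; rewrite !lt_min => /and3P[wr1 wr3 wr4].
have wA : enorm (w *m A) < r1.
  move: wr1; rewrite ltr_pdivlMr ?ltr_wpDl //.
  by have := aP w; have := enorm_ge0 w; nra.
have CKw : C ((u + w) *m A) <-> M0 w by rewrite mulmxDl; exact: r1P.
rewrite -CKw; split.
  move=> [t [z [t0 /cvg0_seqP tc /cvg_enormP zc Gz]]].
  apply: (is_poly_closed Cp) => e e0.
  have [|N1 N1P] := zc (Num.min (r4 / 2) (e / 2 / (a + 1))).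
    by rewrite lt_min !divr_gt0 // ltr_wpDl.
  have c0 : 0 < c by rewrite /c; lra.
  pose b := a * (enorm (u + w) + r4) + c.
  have b0 : 0 < b by rewrite ltr_wpDl // mulr_ge0 // addr_ge0 ?enorm_ge0 // ltW.
  have [|N2 N2P] := tc (Num.min (Num.min r4 1) (Num.min (e / 2 / c) (r2 / b))).
    by rewrite !lt_min r40 ltr01 !divr_gt0.
  pose N := maxn N1 N2; have := N1P N; have := N2P N.
  rewrite !leq_max !leqnn !orbT => /(_ isT) + /(_ isT).
  have tN := t0 N; rewrite gtr0_norm // !lt_min.
  move=> /andP[/andP[tr4 tl1] /andP[te tb]] /andP[zr4 ze].
  have zu : enorm (z N - u) < r4.
    have := enorm_distD (u + w) (z N) u; rewrite [u + w - u]addrC addKr; lra.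
  have := r4P _ _ tN tr4 zu; have := Gz N; rewrite /Gamma /feasible /=.
  set x := xbar + _ => Dx Ex.
  pose q := (t N)^-1 *: (G x - yb).
  have tq : t N *: q = G x - yb by rewrite scalerA mulfV ?scale1r // gt_eqF.
  have qz : enorm (q - z N *m A) <= c * t N.
    rewrite -(@ler_pM2l _ (t N)) //.
    rewrite -[leLHS](_ : enorm (t N *: (q - z N *m A)) = _); last first.
      by rewrite enormZ gtr0_norm.
    rewrite scalerBr tq -addrA -opprD; apply: le_trans Ex _; lra.
  have zb : enorm (z N) <= enorm (u + w) + r4.
    have := enorm_lerB (z N) (u + w); lra.
  have zA := le_trans (aP (z N)) (ler_wpM2l a0 zb).
  exists q.
    rewrite -[q](subrK (z N *m A)) -addrA -mulmxBl.
    apply: le_lt_trans (enormD _ _) _.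
    move: te ze; rewrite !ltr_pdivlMr ?ltr_wpDl // => te ze.
    have := aP (z N - (u + w)); have := enorm_ge0 (z N - (u + w)); lra.
  apply/(is_coneZ _ Cc tN)/r2P; last by rewrite tq subrKC.
  rewrite enormZ gtr0_norm //; move: tb; rewrite ltr_pdivlMr //.
  apply: le_lt_trans; rewrite ler_pM2l // /b.
  have := enorm_lerB q (z N *m A); have := ler_wpM2l (ltW c0) (ltW tl1); lra.
move=> Cw.
have [t1 t10 t1P] := scale_small ((u + w) *m A) r20.
(* MSCQ moves the point by at most [k c t^2] plus the slack [t^2]; division by [t] leaves [b t]. *)
pose b := k * c + 1.
have b0 : 0 < b by rewrite /b /c; have := mulr_ge0 (ltW k0) h0; lra.
pose m := Num.min t1 (Num.min (r3 / 2) (r4 / 2)).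
have m0 : 0 < m by rewrite !lt_min t10 !divr_gt0.
have step i : exists2 z, Gamma (xbar + (m / i.+1%:R) *: z) &
    enorm (z - (u + w)) <= b * (m / i.+1%:R).
  set t := m / i.+1%:R; have t0 : 0 < t by rewrite divr_gt0.
  have tm : t <= m by rewrite ler_pdivrMr // ler_peMr ?(ltW m0) ?ler1n.
  have := tm; rewrite /m !le_min => /and3P[tt1 tr3 tr4].
  have uw3 : enorm (u + w - u) < r3 by rewrite addrC addKr; lra.
  have uw4 : enorm (u + w - u) < r4 by rewrite addrC addKr; lra.
  have Dq : D (yb + t *: ((u + w) *m A)).
    by apply/r2P; [apply: t1P; rewrite gtr0_norm|exact: Cc].
  have t3 : t < r3 by lra.
  have t4 : t < r4 by lra.
  have t2 : 0 < t ^+ 2 by rewrite exprn_gt0.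
  have [x' Gx' xx'] := r3P t (u + w) t0 t3 uw3 _ Dq _ t2.
  exists (t^-1 *: (x' - xbar)).
    by rewrite scalerA mulfV ?scale1r ?subrKC // gt_eqF.
  rewrite -(@ler_pM2l _ t) //.
  rewrite -[leLHS](_ : enorm (t *: (t^-1 *: (x' - xbar) - (u + w))) = _); last first.
    by rewrite enormZ gtr0_norm.
  rewrite scalerBr scalerA mulfV ?gt_eqF // scale1r -addrA -opprD.
  apply: le_trans xx' _.
  have := ler_wpM2l (ltW k0) (r4P _ _ t0 t4 uw4); rewrite /b; lra.
have /choice[z zP] : forall i, exists z, Gamma (xbar + (m / i.+1%:R) *: z) /\
    enorm (z - (u + w)) <= b * (m / i.+1%:R).
  by move=> i; have [z Gz zz] := step i; exists z.
have inv_small e : 0 < e -> exists N : nat, forall k, (N <= k)%N -> m / k.+1%:R < e.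
  move=> e0; have [|N NP] := @invS_small R (e / m); first by rewrite divr_gt0.
  by exists N => i /NP; rewrite ltr_pdivlMr // mulrC.
exists (fun i => m / i.+1%:R), z; split.
- by move=> i; rewrite divr_gt0.
- apply/cvg0_seqP => e /inv_small[N NP]; exists N => i /NP.
  by rewrite ger0_norm // divr_ge0 // ltW.
- apply/cvg_enormP => e e0; have [|N NP] := inv_small (e / b); first by rewrite divr_gt0.
  exists N => i /NP; rewrite ltr_pdivlMr // mulrC => H.
  by apply: le_lt_trans H; case: (zP i).
- by move=> i; case: (zP i).
Qed.

(** For [x] orthogonal to [u], both sides of the proximal inequality at [xbar + t w], with [w] close
    to [u + (t / 2) s], are of order [t^2]; dividing leaves a bound on [dot x s]. *)
Lemma dir_proximal_normalE k : mscq_const G D xbar u k ->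
  dir_proximal_normal Gamma xbar u =
  [set x | exists B, forall s, M s -> dot x s <= B].
Proof.
move=> Hk; have [kp _] := Hk; have k0 := ltW kp; have Ek := mscq_err_bound Hk.
apply/seteqP; split=> x.
  move=> [[_ [delta [rho [gamma [delta0 rho0 gamma0 Hx]]]]] ux].
  have [r r0 rP] := dir_nbhd_ball u delta0 rho0.
  (* The directions satisfy [|w| <= |u| + 1]; the final [1] absorbs the error along the curve. *)
  exists (2 * gamma * (enorm u + 1) ^+ 2 + 1) => s Ms.
  have e0 : 0 < Num.min 1 r by rewrite lt_min ltr01.
  have [r' r'0 r'P] := feasible_curve x Hk Ms e0.
  have [t [t0 tr' tr]] := lt_both r'0 r0.
  have [w [+ Gw]] := r'P t t0 tr'.
  rewrite lt_min => /andP[w1 wr]; rewrite dotBr (dotC x u) ux subr0 ler_norml.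
  move=> /andP[+ _].
  have := Hx _ Gw; rewrite addrC addKr => /(_ (rP _ _ t0 tr wr)).
  rewrite dotZr enormZ gtr0_norm // exprMn => H1 H2.
  have {}H1 : dot x w <= t * (gamma * enorm w ^+ 2).
    by rewrite -(ler_pM2l t0); apply: le_trans H1 _; lra.
  have wb : enorm w <= enorm u + 1 by have := enorm_lerB w u; lra.
  have w2 : enorm w ^+ 2 <= (enorm u + 1) ^+ 2.
    by rewrite ler_pXn2r ?nnegrE ?enorm_ge0 // ltW // enorm1_gt0.
  have := ler_wpM2l (ltW gamma0) w2.
  have m1 : Num.min 1 r <= 1 by rewrite ge_min lexx.
  have {}H2 : dot x s - 1 <= 2 * (gamma * enorm w ^+ 2).
    by rewrite -(ler_pM2l t0); have := ler_wpM2l (ltW t0) m1; lra.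
  lra.
move=> [B BP]; have ux : dot u x = 0.
  by apply/polar_orth/(bounded_above_polar x k0 Ek); exists B.
split=> //; split.
  by apply/(local_coneT (tangent_cone_feasible Hk)); rewrite /M0 /= mul0mx.
have [r r0 rP] := feasible_slope k0 Ek ux BP ltr01.
have [delta [rho [c [delta0 rho0 c0 H]]]] := dir_nbhd_polar u r0.
have B1 : 0 < `|B| + 1 by rewrite ltr_wpDl.
exists delta, rho, (c * (`|B| + 1)); rewrite mulr_gt0 //; split=> // z Gz /H.
have [-> _|xz] := eqVneq (z - xbar) 0.
  by rewrite dot0r enorm0 expr0n mulr0.
move=> /(_ isT)[t [w [/andP[t0 tr] wr zw tc]]].
have := rP t w t0 tr wr; rewrite -zw subrKC => /(_ Gz) xw.
have -> : dot x (z - xbar) = t * dot x w by rewrite zw dotZr.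
have := ler_norm B; have := normr_ge0 B; move=> B0 BB.
have := ler_wpM2l (ltW t0) xw.
have := ler_wpM2r (ltW B1) tc.
have : t ^+ 2 * (B + 1) <= t ^+ 2 * (`|B| + 1) by rewrite ler_wpM2l ?sqr_ge0 //; lra.
have := mulr_ge0 (sqr_ge0 t) (ltW B1); lra.
Qed.

End constraint_system.


(** * Support functions and second subderivatives as extended reals *)

Section extended_values.
Context {R : realType} {n : nat}.

Lemma effdom_support (M : set 'rV[R]_n) :
  effdom (support_fun M) = [set x | exists B, forall s, M s -> dot x s <= B].
Proof.
apply/seteqP; split=> x; rewrite /effdom /=; last first.
  move=> [B BP]; apply: (@le_lt_trans _ _ B%:E); last exact: ltry.
  by apply: ge_ereal_sup => _ [s Ms <-]; rewrite lee_fin BP.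
have ub s : M s -> ((dot x s)%:E <= support_fun M x)%E.
  by move=> Ms; apply: ereal_sup_ubound; exists s.
case E : (support_fun M x) ub => [r| |] // ub _.
  by exists r => s /ub; rewrite lee_fin.
(* The supremum is [-oo] only for empty [M], where any bound serves. *)
by exists 0 => s /ub; rewrite leeNy_eq.
Qed.

Lemma support_fun_real (M : set 'rV[R]_n) x : M !=set0 ->
  (exists B, forall s, M s -> dot x s <= B) ->
  exists sg, [/\ support_fun M x = sg%:E, forall s, M s -> dot x s <= sg &
    forall e, 0 < e -> exists2 s, M s & sg - e < dot x s].
Proof.
move=> [s0 Ms0] HB; have : effdom (support_fun M) x by rewrite effdom_support.
have ub s : M s -> ((dot x s)%:E <= support_fun M x)%E.
  by move=> Ms; apply: ereal_sup_ubound; exists s.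
rewrite /effdom /=; case E : (support_fun M x) ub => [sg| |] // ub _; last first.
  by have := ub _ Ms0; rewrite leeNy_eq.
exists sg; split=> // e e0.
have [] := @ereal_sup_gt R [set (dot x z)%:E | z in M] (sg - e)%:E.
  by rewrite -/(support_fun M x) E lte_fin ltrBlDr ltrDl.
by move=> _ [s Ms <-]; rewrite lte_fin; exists s.
Qed.

Lemma within_cone_filterP (P V : set (R * 'rV[R]_n)) (w : 'rV[R]_n) :
  within P (filter_prod (0 : R)^'+ (nbhs w)) V <->
  exists2 r, 0 < r & forall t z, 0 < t -> t < r -> enorm (z - w) < r ->
    P (t, z) -> V (t, z).
Proof.
split.
  move=> [[V1 V2] /= [/nbhs_ballP[r1 /= r10 r1P] /nbhs_enormP[r2 r20 r2P] V12]].
  exists (Num.min r1 r2); first by rewrite lt_min r10.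
  move=> t z t0; rewrite !lt_min => /andP[tr1 _] /andP[_ zr2].
  apply: (V12 (t, z)); split=> /=; last exact: r2P.
  by apply: r1P => //; rewrite /ball /= sub0r normrN gtr0_norm.
move=> [r r0 rP].
exists ([set t | 0 < t < r], [set z | enorm (z - w) < r]).
  split=> /=; last by apply/nbhs_enormP; exists r.
  apply/nbhs_ballP; exists r => //= t; rewrite /ball /= sub0r normrN => tr t0.
  by rewrite t0 -(gtr0_norm t0).
by move=> [t z] /= [/andP[t0 tr] zr]; exact: rP.
Qed.

(** The curve hypothesis bounds the liminf above, the slope hypothesis below. For an infinite
    support value the lower bound is trivial. *)
Lemma subderiv2_indic_support (S M : set 'rV[R]_n) z u x : M !=set0 ->
  (forall sg, (forall s, M s -> dot x s <= sg) -> forall e, 0 < e ->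
     exists2 r, 0 < r & forall t w, 0 < t -> t < r -> enorm (w - u) < r ->
       S (z + t *: w) -> 2 * dot x w <= t * (sg + e)) ->
  (forall s, M s -> forall e, 0 < e -> exists2 r, 0 < r & forall t, 0 < t -> t < r ->
     exists w, [/\ enorm (w - u) < e, S (z + t *: w) &
       `|2 * dot x w - t * dot x s| <= t * e]) ->
  subderiv2_indic S z x u = (- support_fun M x)%E.
Proof.
move=> M0 slope curve; rewrite /subderiv2_indic limf_einfE.
apply/eqP; rewrite eq_le; apply/andP; split.
  apply: ge_ereal_sup => _ [V /within_cone_filterP[r r0 rP] <-].
  rewrite leeNr; apply: ge_ereal_sup => _ [s Ms <-]; rewrite leeNr.
  apply/lee_addgt0Pr => e e0.
  have m0 : 0 < Num.min r e by rewrite lt_min r0.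
  have [r' r'0 r'P] := curve s Ms _ m0.
  have [t [t0 tr' tr]] := lt_both r'0 r0.
  have [w [+ Sw]] := r'P t t0 tr'; rewrite lt_min => /andP[wr _].
  have me : Num.min r e <= e by rewrite ge_min lexx orbT.
  rewrite ler_norml => /andP[H _].
  apply: ereal_inf_le; exists (- 2 * dot x w / t)%:E.
    by exists (t, w) => //; exact: rP.
  rewrite -EFinN -EFinD lee_fin ler_pdivrMr //.
  have := ler_wpM2l (ltW t0) me; lra.
have [E|nE] := eqVneq (support_fun M x) +oo%E; first by rewrite E leNye.
have [|sg [-> Msg _]] := support_fun_real M0 (x := x).
  have : effdom (support_fun M) x by rewrite /effdom /= ltey.
  by rewrite effdom_support.
apply/lee_subgt0Pr => e e0; have [r r0 rP] := slope sg Msg e e0.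
apply: (@le_trans _ _ (ereal_inf ((fun p : R * 'rV[R]_n => (- 2 * dot x p.2 / p.1)%:E) @`
   [set p | [/\ 0 < p.1, p.1 < r, enorm (p.2 - u) < r & S (z + p.1 *: p.2)]]))).
  apply: le_ereal_inf_tmp => _ [[t w] /= [t0 tr wr Sw] <-].
  rewrite -EFinD lee_fin ler_pdivlMr //.
  by have := rP t w t0 tr wr Sw; lra.
apply: ereal_sup_ubound; exists [set p | [/\ 0 < p.1, p.1 < r, enorm (p.2 - u) < r
  & S (z + p.1 *: p.2)]] => //.
by apply/within_cone_filterP; exists r.
Qed.

(** The bound [b] excludes the value [-oo], so the liminf is real and approached along normals
    tending to [x]. *)
Lemma lower_support_approx (M : set 'rV[R]_n) x b : M !=set0 ->
  (forall z x', enorm (x' - x) < 1 -> regular_normal M z x' -> b <= dot x' z) ->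
  effdom (lower_support M) x ->
  exists l, lower_support M x = l%:E /\ forall e, 0 < e -> exists x' z,
    [/\ regular_normal M z x', enorm (x' - x) <= e & `|dot x' z - l| <= e].
Proof.
move=> M0 bP; rewrite /effdom /= /lower_support asboolF; last first.
  by move=> E; move: M0; rewrite E => -[].
rewrite limf_einfE.
set f : 'rV[R]_n -> \bar R := fun zt => ereal_inf [set (dot zt z)%:E | z in _].
set L := ereal_sup _ => Loo.
have near_ball e : 0 < e -> nbhs x [set x' | enorm (x' - x) < e].
  by move=> e0; apply/nbhs_enormP; exists e.
have bL : (b%:E <= L)%E.
  apply: (@le_trans _ _ (ereal_inf (f @` [set x' | enorm (x' - x) < 1]))).
    apply: le_ereal_inf_tmp => _ [x' /= xx' <-].
    apply: le_ereal_inf_tmp => _ [z /= Nz <-]; rewrite lee_fin; exact: bP.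
  apply: ereal_sup_ubound; exists [set x' | enorm (x' - x) < 1] => //.
  exact: near_ball.
case E : L Loo bL => [l| |] // _ _; exists l; split=> // e e0.
have [] := @ereal_sup_gt R [set ereal_inf (f @` V) | V in nbhs x] (l - e)%:E.
  by rewrite -/L E lte_fin ltrBlDr ltrDl.
move=> _ [V xV <-] lV.
(* [V] keeps all values above [l - e]; its intersection with the ball is still a neighbourhood, so
   some value there is below [l + e]. *)
have [] := @ereal_inf_lt R (f @` (V `&` [set x' | enorm (x' - x) < e])) (l + e)%:E.
  apply: (@le_lt_trans _ _ L); last by rewrite E lte_fin ltrDl.
  apply: ereal_sup_ubound; exists (V `&` [set x' | enorm (x' - x) < e]) => //.
  by apply: filterI => //; exact: near_ball.
move=> _ [x' [Vx' /= xx'] <-] /ereal_inf_lt[_ [z /= Nz <-]].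
rewrite lte_fin => zl; exists x', z; split=> //; first exact: ltW.
have : (f x' <= (dot x' z)%:E)%E by apply: ereal_inf_lbound; exists z.
have : (ereal_inf (f @` V) <= f x')%E by apply: ereal_inf_lbound; exists x'.
move=> /(lt_le_trans lV) H /(lt_le_trans H); rewrite lte_fin ler_norml.
by move=> ?; apply/andP; split; lra.
Qed.

End extended_values.


(** * Assembly of the three statements from [K], [M] and the error bound *)

Theorem theorem5p1 (R : realType) (n d : nat) (G : 'rV[R]_n -> 'rV[R]_d)
    (D : set 'rV[R]_d) (xbar u : 'rV[R]_n) (kappa : R)
    (hG : twice_cont_diff G) (hD : polyhedral D)
    (hxbar : feasible G D xbar) (hu : lin_cone G D xbar u)
    (hmscq : mscq G D xbar u) (hkappa : kappa = subreg_modulus G D xbar u) :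
  let Gamma := feasible G D in
  let T2 := tangent_set2 Gamma xbar u in
  let d2 := fun xs : 'rV[R]_n => subderiv2_indic Gamma xbar xs u in
  let q := fun y : 'rV[R]_d => (dot y (hess_quad G xbar u))%:E in
  let Lam := multipliers G D xbar u in
  let Lam_s := multipliers_s G D xbar u in
  let Lam_k := fun xs : 'rV[R]_n => Lam xs `&` cl_eball (kappa * enorm xs) in
  [/\ (forall xs, orth u xs -> d2 xs = (- support_fun T2 xs)%E),
      [/\ effdom (support_fun T2) = dir_proximal_normal Gamma xbar u,
          dir_proximal_normal Gamma xbar u =
            regular_normal (tangent_cone Gamma xbar) u
        & forall xs, effdom (support_fun T2) xs ->
            [/\ orth u xs,
                d2 xs = (- support_fun T2 xs)%E,
                (ereal_inf [set q y | y in Lam_k xs] <= d2 xs /\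
                 d2 xs <= ereal_sup [set q y | y in Lam_k xs])%E,
                (ereal_sup [set q y | y in Lam_s xs] <= d2 xs)%E
              & exists2 y, Lam xs y & d2 xs = q y]]
    & [/\ effdom (lower_support T2) `<=` [set xs | Lam xs !=set0],
          (forall xs, effdom (lower_support T2) xs ->
             [/\ (ereal_inf [set q y | y in Lam_k xs]
                    <= - lower_support T2 xs)%E,
                 (- lower_support T2 xs
                    <= ereal_sup [set q y | y in Lam_k xs])%E
               & exists2 y, Lam xs y & (- lower_support T2 xs)%E = q y])
        & forall xs, (- lower_support T2 xs
                        <= ereal_sup [set q y | y in Lam_k xs])%E]].
Proof.
move=> Gamma T2 d2 q Lam Lam_s Lam_k.
have [C [Cp Cc DC]] := is_poly_local_cone (G xbar) (polyhedral_is_poly hD).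
have TC : tangent_cone D (G xbar) = C by exact: tangent_cone_local.
have Cv : C (u *m 'J G xbar) by rewrite -TC.
have [K [Kp Kc CK]] := is_poly_local_cone (u *m 'J G xbar) Cp.
have K0 : K 0 by exact/(local_coneT CK).
have [k hk] := hmscq; have [kp _] := hk; have k0 := ltW kp.
set A := 'J G xbar in Cv CK; set h := hess_quad G xbar u in q *.
have T2E : T2 = [set s | K (s *m A + h)] := tangent_set2E hG Cc DC Kp Kc CK hk.
have Eb k' : mscq_const G D xbar u k' -> err_bound A h K k'.
  exact: (mscq_err_bound hG Cc DC Kp Kc CK).
have kappa_ge0 : 0 <= kappa.
  rewrite hkappa; apply: lb_le_inf; first by exists k.
  by move=> k' [/ltW].
have Ek e : 0 < e -> exists2 k, 0 <= k <= kappa + e & err_bound A h K k.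
  move=> e0; have [||k' hk' kk'] := @inf_adherent _ [set k | mscq_const G D xbar u k] e.
  - by [].
  - by split; [exists k|exists 0 => k' [/ltW]].
  - exists k'; last exact: Eb.
    by have [/ltW -> _] := hk'; rewrite hkappa ltW.
have T2p : is_poly T2 by rewrite T2E; exact: is_poly_affine_preimage.
(* The error bound at [s = 0], [p = 0] already produces a point of [M]. *)
have [s0 Ts0] : T2 !=set0.
  by rewrite T2E; have [s Ks _] := Eb k hk 0 0 K0 1 ltr01; exists s.
have T2n : T2 !=set0 by exists s0.
have d2E xs : orth u xs -> d2 xs = (- support_fun T2 xs)%E.
  move=> uxs; apply: subderiv2_indic_support => //.
    move=> sg Hsg; apply: (feasible_slope hG Cc DC Kc CK k0 (Eb k hk) uxs).
    by rewrite T2E in Hsg.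
  move=> s; rewrite T2E => Ms e e0.
  have [r r0 rP] := feasible_curve hG Cc DC Kc CK xs hk Ms e0.
  exists r => // t t0 tr; have [w [wu Gw wt]] := rP t t0 tr.
  by exists w; split=> //; move: wt; rewrite dotBr (dotC xs u) uxs subr0.
have polarE xs : (exists B, forall s, T2 s -> dot xs s <= B) <->
    (forall w, K (w *m A) -> dot xs w <= 0).
  by rewrite T2E; exact: (bounded_above_polar Kp Kc xs k0 (Eb k hk)).
have proxE : dir_proximal_normal Gamma xbar u =
    [set x | exists B, forall s, T2 s -> dot x s <= B].
  by rewrite T2E; exact: (dir_proximal_normalE hG Cp Cc DC Kp Kc CK Cv hk).
have TG : local_cone (tangent_cone Gamma xbar) u [set w | K (w *m A)].
  exact: (tangent_cone_feasible hG Cp Cc DC CK hk).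
have TGu : tangent_cone Gamma xbar u.
  by apply/(local_coneT TG); rewrite /= mul0mx.
have M0c : is_cone [set w : 'rV[R]_n | K (w *m A)].
  by move=> t w t0 /= Kw; rewrite -scalemxAl; exact: Kc.
have LamE xs y : Lam xs y <-> limiting_normal C (u *m A) y /\ xs = y *m A^T.
  by rewrite /Lam /multipliers -TC.
have mult xs c : (forall e, 0 < e -> exists x' z,
    [/\ regular_normal T2 z x', enorm (x' - xs) <= e & `|dot x' z + c| <= e]) ->
    exists2 y, Lam_k xs y & q y = c%:E.
  rewrite T2E => H.
  have [y [Ny xy yk yh]] := multiplier_limit Kp Kc CK Cv kappa_ge0 Ek H.
  by exists y; [split=> //; apply/LamE|rewrite /q yh].
have sandwich xs c y : Lam_k xs y -> q y = c ->
    (ereal_inf [set q y | y in Lam_k xs] <= c /\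
     c <= ereal_sup [set q y | y in Lam_k xs])%E.
  move=> Ly <-; split; first by apply: ereal_inf_lbound; exists y.
  by apply: ereal_sup_ubound; exists y.
split=> //; first split.
- by rewrite proxE effdom_support.
- rewrite proxE; apply/seteqP; split=> xs.
    by move=> /polarE H; exact: polar_regular_normal TG TGu H.
  by move=> /(regular_normal_local_polar M0c TG) H; apply/polarE.
- move=> xs; rewrite effdom_support => HB.
  have uxs : orth u xs by exact: (polar_orth Cc CK Cv ((polarE xs).1 HB)).
  have [sg [sgE sgle sgge]] := support_fun_real T2n HB.
  have d2sg : d2 xs = (- sg)%:E by rewrite d2E // sgE.
  have [|y Ly qy] := mult xs (- sg); first exact: sup_approx_normal T2p sgle sgge.
  split=> //; first exact: d2E.
  + by rewrite d2sg; exact: sandwich Ly qy.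
  + rewrite d2sg; apply: ge_ereal_sup => _ [y' [Ny' xy'] <-].
    rewrite /q lee_fin lerNr; rewrite TC in Ny'.
    (* Since [y'] is polar to [K], every [s] in [T2] has [dot xs s <= - dot y' h], and the supremum
       [sg] inherits the bound. *)
    have Py' := regular_normal_local_polar Kc CK Ny'.
    rewrite leNgt; apply/negP => lt_sg.
    have [|s Ts] := sgge (sg + dot y' h); first by lra.
    rewrite T2E /= in Ts; have := Py' _ Ts.
    by rewrite dotDr xy' (dotC (y' *m _)) -dot_mulmx (dotC (s *m _)); lra.
  + by exists y; [case: Ly|rewrite qy].
have lowmult xs : effdom (lower_support T2) xs ->
    exists2 y, Lam_k xs y & q y = (- lower_support T2 xs)%E.
  move=> Hxs.
  (* Near [xs] the approximate multipliers have norm at most [k (|xs| + 1) + 1], and [dot x' z] is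
     within [1] of [- dot y h]. *)
  have [|l [-> H]] := @lower_support_approx R n T2 xs
      (- ((k * (enorm xs + 1) + 1) * enorm h + 1)) T2n _ Hxs.
    move=> z x' xx' Nx'; rewrite T2E in Nx'.
    have [y [p [_ _ yk]]] := normal_multiplier Kp Kc k0 (Eb k hk) Nx' ltr01.
    rewrite ler_norml => /andP[H1 _].
    have xb : enorm x' <= enorm xs + 1 by have := enorm_lerB x' xs; lra.
    have := dot_le y h; have := ler_wpM2l k0 xb => H2 H3.
    have : enorm y * enorm h <= (k * (enorm xs + 1) + 1) * enorm h.
      by rewrite ler_wpM2r ?enorm_ge0 //; lra.
    lra.
  by apply: mult => e /H[x' [z [Nz xx' zl]]]; exists x', z.
split.
- by move=> xs /lowmult[y [Ly _] _]; exists y.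
- move=> xs /lowmult[y Ly qy]; have [H1 H2] := sandwich _ _ _ Ly qy.
  by split=> //; exists y => //; case: Ly.
(* At [+oo] the left side is [-oo], which is below even a supremum over the empty set. *)
- move=> xs; have [E|nE] := eqVneq (lower_support T2 xs) +oo%E.
    by rewrite E leNye.
  have [|y Ly qy] := lowmult xs; first by rewrite /effdom /= ltey.
  by have [] := sandwich _ _ _ Ly qy.
Qed.
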